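(* Let $\gamma\in[0,2]$, let $\mathcal{O}\subset\mathbb{R}^d$ be a bounded $C^1$ domain, and let $q:\overline{\mathcal{O}}\to\mathbb{R}^d$ and $c:\overline{\mathcal{O}}\to\mathbb{R}$ be continuous. Let $\lambda_{\mathcal{O}}$ be the principal eigenvalue defined in the context. Then there exists a positive viscosity solution $\varphi$ (that is, $\varphi>0$ in $\mathcal{O}$) of $$\Delta_\infty^\gamma\varphi+q(x)\cdot\nabla\varphi\,|\nabla\varphi|^{2-\gamma}+c(x)\varphi^{3-\gamma}+\lambda_{\mathcal{O}}\,\varphi^{3-\gamma}=0\ \text{ in }\mathcal{O},\qquad\varphi=0\ \text{ on }\partial\mathcal{O}.$$
   Context: For a $C^2$ function $\varphi$, $\Delta_\infty^\gamma\varphi=|\nabla\varphi|^{-\gamma}\sum_{i,j=1}^d\partial_{x_i}\varphi\,\partial_{x_ix_j}\varphi\,\partial_{x_j}\varphi$, and $\mathcal{L}\varphi=\Delta_\infty^\gamma\varphi+q(x)\cdot\nabla\varphi\,|\nabla\varphi|^{2-\gamma}$. The principal eigenvalue is $$\lambda_{\mathcal{O}}=\sup\{\lambda\in\mathbb{R}:\exists\,\varphi\in C(\overline{\mathcal{O}})\text{ with }\mathcal{L}\varphi+c(x)\varphi^{3-\gamma}+\lambda\varphi^{3-\gamma}\le0\text{ in }\mathcal{O}\text{ and }\min_{\overline{\mathcal{O}}}\varphi>0\},$$ the inequality being in the viscosity sense. Viscosity sense: consider an equation $\Delta_\infty^\gamma u+G(x,u,\nabla u)=0$ in an open set $U\subset\mathbb{R}^d$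 with $G$ continuous. An upper-semicontinuous $u$ is a subsolution (satisfies the inequality $\ge0$) if, whenever $x_0\in U$ and $\varphi$ is $C^2$ near $x_0$ with $u(x_0)=\varphi(x_0)$ and $u<\varphi$ in a punctured ball around $x_0$, one has $\Delta_\infty^\gamma\varphi(x_0)+G(x_0,u(x_0),\nabla\varphi(x_0))\ge0$; if $\nabla\varphi(x_0)=0$, the term $\Delta_\infty^\gamma\varphi(x_0)$ is read as $0$ when $\gamma<2$ and as $M(D^2\varphi(x_0))=\max_{|\xi|=1}\langle\xi,D^2\varphi(x_0)\xi\rangle$ when $\gamma=2$. A lower-semicontinuous $u$ is a supersolution (satisfies $\le0$) if, whenever $\varphi$ is $C^2$ near $x_0$ with $u(x_0)=\varphi(x_0)$ and $u>\varphi$ in a punctured ball around $x_0$, one has $\Delta_\infty^\gamma\varphi(x_0)+G(x_0,u(x_0),\nabla\varphi(x_0))\le0$; if $\nabla\varphi(x_0)=0$, $\Delta_\infty^\gamma\varphi(x_0)$ is read as $0$ when $\gamma<2$ and as $m(D^2\varphi(x_0))=\min_{|\xi|=1}\langle\xi,D^2\varphi(x_0)\xi\rangle$ when $\gamma=2$. A viscosity solution is both; in the Dirichlet problem it is continuous on $\overline{\mathcal{O}}$ with the prescribed boundary values. *)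

(* Defs.v *)
From HB Require Import structures.
From mathcomp Require Import all_boot all_order all_algebra.
From mathcomp Require Import all_classical all_reals all_analysis.
Set Implicit Arguments.
Unset Strict Implicit.
Unset Printing Implicit Defensive.
Import Order.TTheory GRing.Theory Num.Theory.
Import numFieldNormedType.Exports.
Local Open Scope classical_set_scope.
Local Open Scope ring_scope.

(* R^n is 'rV[R]_n. The library norm `|x| on it is the sup norm; it is used
   only through the topology and boundedness, which agree with the Euclidean
   ones. Lengths of vectors are measured with [enorm]. *)

Definition dotv {R : realType} {n : nat} (x y : 'rV[R]_n) : R :=
  \sum_(i < n) x 0 i * y 0 i.

Definition enorm {R : realType} {n : nat} (x : 'rV[R]_n) : R :=
  Num.sqrt (dotv x x).

Definition partial {R : realType} {n : nat} (i : 'I_n) (f : 'rV[R]_n -> R)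
    (x : 'rV[R]_n) : R :=
  'D_(delta_mx 0 i) f x.

Definition partial_C0_at {R : realType} {n : nat} (i : 'I_n)
    (f : 'rV[R]_n -> R) (x : 'rV[R]_n) : Prop :=
  derivable f x (delta_mx 0 i) /\ {for x, continuous (partial i f)}.

Definition C1 {R : realType} {n : nat} (f : 'rV[R]_n -> R) : Prop :=
  forall x i, partial_C0_at i f x.

Definition C2_near {R : realType} {n : nat} (f : 'rV[R]_n -> R)
    (x0 : 'rV[R]_n) : Prop :=
  \forall x \near x0, forall i,
    partial_C0_at i f x /\ forall j, partial_C0_at j (partial i f) x.

Definition gradient {R : realType} {n : nat} (f : 'rV[R]_n -> R)
    (x : 'rV[R]_n) : 'rV[R]_n :=
  \row_i partial i f x.

Definition hessian {R : realType} {n : nat} (f : 'rV[R]_n -> R)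
    (x : 'rV[R]_n) : 'M[R]_n :=
  \matrix_(i, j) partial j (partial i f) x.

(* The unit sphere is compact, and nonempty for n >= 1, so for n >= 1 the
   supremum and infimum below are a maximum and a minimum. *)
Definition max_quad {R : realType} {n : nat} (H : 'M[R]_n) : R :=
  sup [set dotv xi (xi *m H^T) | xi in [set xi : 'rV[R]_n | enorm xi = 1]].

Definition min_quad {R : realType} {n : nat} (H : 'M[R]_n) : R :=
  inf [set dotv xi (xi *m H^T) | xi in [set xi : 'rV[R]_n | enorm xi = 1]].

(* Value of Delta_infty^gamma f at x, the value when the gradient vanishes and
   gamma = 2 being [crit] of the Hessian. *)
Definition inf_laplacian {R : realType} {n : nat} (crit : 'M[R]_n -> R)
    (gamma : R) (f : 'rV[R]_n -> R) (x : 'rV[R]_n) : R :=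
  if gradient f x != 0 then
    enorm (gradient f x) `^ (- gamma) *
    \sum_(i < n) \sum_(j < n)
      partial i f x * partial j (partial i f) x * partial j f x
  else if gamma < 2 then 0 else crit (hessian f x).

Definition usc_on {R : realType} {n : nat} (U : set 'rV[R]_n)
    (u : 'rV[R]_n -> R) : Prop :=
  forall x, U x -> forall a, u x < a -> \forall y \near within U (nbhs x), u y < a.

Definition lsc_on {R : realType} {n : nat} (U : set 'rV[R]_n)
    (u : 'rV[R]_n -> R) : Prop :=
  forall x, U x -> forall a, a < u x -> \forall y \near within U (nbhs x), a < u y.

(* Viscosity notions for Delta_infty^gamma u + G(x, u, grad u) = 0 in an open
   set U; x0^' is the filter of punctured neighbourhoods of x0. *)
Definition visc_subsolution {R : realType} {n : nat} (gamma : R)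
    (G : 'rV[R]_n -> R -> 'rV[R]_n -> R) (U : set 'rV[R]_n)
    (u : 'rV[R]_n -> R) : Prop :=
  usc_on U u /\
  forall (x0 : 'rV[R]_n) (psi : 'rV[R]_n -> R),
    U x0 -> C2_near psi x0 -> u x0 = psi x0 ->
    (\forall x \near x0^', u x < psi x) ->
    0 <= inf_laplacian max_quad gamma psi x0 + G x0 (u x0) (gradient psi x0).

Definition visc_supersolution {R : realType} {n : nat} (gamma : R)
    (G : 'rV[R]_n -> R -> 'rV[R]_n -> R) (U : set 'rV[R]_n)
    (u : 'rV[R]_n -> R) : Prop :=
  lsc_on U u /\
  forall (x0 : 'rV[R]_n) (psi : 'rV[R]_n -> R),
    U x0 -> C2_near psi x0 -> u x0 = psi x0 ->
    (\forall x \near x0^', psi x < u x) ->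
    inf_laplacian min_quad gamma psi x0 + G x0 (u x0) (gradient psi x0) <= 0.

Definition visc_solution {R : realType} {n : nat} (gamma : R)
    (G : 'rV[R]_n -> R -> 'rV[R]_n -> R) (U : set 'rV[R]_n)
    (u : 'rV[R]_n -> R) : Prop :=
  visc_subsolution gamma G U u /\ visc_supersolution gamma G U u.

Definition boundary {T : topologicalType} (A : set T) : set T :=
  closure A `\` interior A.

(* Near each boundary point, in suitable orthonormal coordinates x *m Q, the
   set O is the part lying strictly above the graph of a C^1 function of the
   first d coordinates. *)
Definition C1_boundary {R : realType} {d : nat} (O : set 'rV[R]_d.+1) : Prop :=
  forall x0, boundary O x0 ->
  exists (Q : 'M[R]_d.+1) (g : 'rV[R]_d -> R),
    [/\ Q *m Q^T = 1%:M, C1 g &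
        \forall x \near x0,
          O x <-> g (col' ord_max (x *m Q)) < (x *m Q) 0 ord_max].

Definition bounded_C1_domain {R : realType} {d : nat}
    (O : set 'rV[R]_d.+1) : Prop :=
  [/\ open O, connected O, O !=set0, bounded_set O & C1_boundary O].

Definition eigen_G {R : realType} {n : nat} (gamma : R)
    (q : 'rV[R]_n -> 'rV[R]_n) (c : 'rV[R]_n -> R) (lambda : R)
    (x : 'rV[R]_n) (r : R) (p : 'rV[R]_n) : R :=
  dotv (q x) p * enorm p `^ (2 - gamma)
  + c x * r `^ (3 - gamma) + lambda * r `^ (3 - gamma).

(* For phi continuous on the compact set closure O, the infimum of phi over
   closure O is its minimum. *)
Definition admissible {R : realType} {n : nat} (gamma : R)
    (q : 'rV[R]_n -> 'rV[R]_n) (c : 'rV[R]_n -> R) (O : set 'rV[R]_n)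
    (lambda : R) : Prop :=
  exists phi : 'rV[R]_n -> R,
    [/\ {within closure O, continuous phi},
        visc_supersolution gamma (eigen_G gamma q c lambda) O phi &
        0 < inf (phi @` closure O)].

(* For a bounded nonempty open set and bounded q, c the set of admissible values
   is nonempty (constants are supersolutions for very negative lambda) and
   bounded above, so [sup] is not its default value. *)
Definition principal_eigenvalue {R : realType} {n : nat} (gamma : R)
    (q : 'rV[R]_n -> 'rV[R]_n) (c : 'rV[R]_n -> R) (O : set 'rV[R]_n) : R :=
  sup [set lambda | admissible gamma q c O lambda].

(* Main.v *)
(* The functions w = a + b exp(-k |x - z|) satisfy
   Delta_infty^gamma w = sgn(b) k |grad w|^(3 - gamma) away from z, so for k large
   they are strict classical super- or subsolutions there. Comparing with these
   cones, whose vertex z is arbitrary, needs only classical test functions and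
   gives at once
   - for nonnegative bounded subsolutions vanishing off O: a Lipschitz bound on
     the whole space, boundary included (so no boundary regularity is used);
   - for nonnegative supersolutions: a Harnack inequality, hence the strong
     minimum principle and the boundedness of the set of admissible values.
   Since the Lipschitz bound holds for every subsolution, Perron's method
   between 0 and a large multiple of an admissible function solves, for lambda
   below the eigenvalue, the equation with right-hand side -1 and zero boundary
   values, without any comparison principle for two viscosity solutions. These
   solutions blow up as lambda tends to the eigenvalue: otherwise one of them plus
   a small constant would be admissible for a larger lambda. Normalizing and
   passing to the limit by Arzela-Ascoli gives the eigenfunction. *)
Require Import Defs.
From mathcomp Require Import all_boot all_order all_algebra.
From mathcomp Require Import ring lra.
From mathcomp Require Import all_classical all_reals all_analysis.
Import Order.TTheory GRing.Theory Num.Theory.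
Import numFieldNormedType.Exports.
Local Open Scope classical_set_scope.
Local Open Scope ring_scope.
Set Implicit Arguments.
Unset Strict Implicit.
Unset Printing Implicit Defensive.

(** * Directional derivatives and test functions *)

(** The coefficient [c + lambda] may have either sign, so the equation is not monotone in the
    unknown and two viscosity solutions cannot be compared directly; this is why each estimate
    compares one function with an explicit one. The scheme rests on homogeneity: the operator, the
    drift and the power term all scale with degree 3 - gamma. Dividing a solution with source 1 by
    its maximum M therefore leaves the source M^-(3 - gamma), and blow-up of M is exactly what makes
    the source disappear in the limit. The same source drives the blow-up argument: while M stays
    bounded, it absorbs both the cost of adding a small constant and the cost of raising lambda
    across the eigenvalue. Candidates are extended by zero to the whole space. A Lipschitz bound for
    all of them at once makes the Perron supremum continuous, so semicontinuous envelopes never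
    appear, and it keeps the zero boundary values without barriers. *)

Lemma near_eq_continuous_at (T U : topologicalType) (f g : T -> U) (x : T) :
  {near x, f =1 g} -> {for x, continuous f} -> {for x, continuous g}.
Proof.
move=> e fc; have e1 := nbhs_singleton e.
change (g y @[y --> x] --> g x); rewrite -e1; apply: cvg_trans fc.
exact: near_eq_cvg.
Qed.

Section Calculus.
Context {R : realType} {n : nat}.
Implicit Types (f g : 'rV[R]_n -> R) (x v : 'rV[R]_n).

Let line_quotient f x v t :
  (fun h : R => h^-1 *: (f (x + (h *: 1 + t) *: v) - f (x + t *: v))) =
  (fun h : R => h^-1 *: (f (h *: v + (x + t *: v)) - f (x + t *: v))).
Proof.
apply/funext => h; congr (_ *: (f _ - _)).
have -> : h *: (1 : R) = h by exact: mulr1.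
by rewrite scalerDl addrCA.
Qed.

Lemma is_derive_line f x v t df :
  is_derive (x + t *: v) v f df ->
  is_derive t 1 (fun s : R => f (x + s *: v)) df.
Proof.
move=> [fd fE]; apply: DeriveDef.
- by rewrite /derivable /= line_quotient.
- by rewrite -fE /derive /= line_quotient.
Qed.

Lemma line_is_derive f x v df :
  is_derive (0 : R) 1 (fun s : R => f (x + s *: v)) df -> is_derive x v f df.
Proof.
move=> [fd fE]; have xE : x = x + 0 *: v by rewrite scale0r addr0.
apply: DeriveDef.
- by move: fd; rewrite /derivable /= line_quotient -xE.
- by move: fE; rewrite /derive /= line_quotient -xE.
Qed.

(** Only the derivative of [g] along [v] is assumed to exist, so the chain rule is imported from
    dimension one by restricting to a line. *)
Lemma is_derive_comp (h : R -> R) g x v a b :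
  is_derive (g x) 1 h a -> is_derive x v g b ->
  is_derive x v (h \o g) (a * b).
Proof.
move=> hd gd; apply: line_is_derive.
apply: (@is_derive1_comp R h (fun s : R => g (x + s *: v)) 0).
  by rewrite scale0r addr0.
by apply: is_derive_line; rewrite scale0r addr0.
Qed.

(** Candidates [F] and [H] for the derivatives are carried explicitly, so that regularity of a
    formula is checked by derivative rules instead of by computing with [partial]. *)
Definition C2_at f (F : 'I_n -> 'rV[R]_n -> R)
    (H : 'I_n -> 'I_n -> 'rV[R]_n -> R) x :=
  forall i,
    [/\ is_derive x (delta_mx 0 i) f (F i x), {for x, continuous (F i)} &
        forall j, is_derive x (delta_mx 0 j) (F i) (H i j x) /\
                  {for x, continuous (H i j)}].

Definition C2_with f (F : 'I_n -> 'rV[R]_n -> R)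
    (H : 'I_n -> 'I_n -> 'rV[R]_n -> R) x0 :=
  \forall x \near x0, C2_at f F H x.

Lemma C2_with_jet f F H x0 : C2_with f F H x0 ->
  [/\ C2_near f x0, gradient f x0 = \row_i F i x0 &
      hessian f x0 = \matrix_(i, j) H i j x0].
Proof.
move=> fC.
have PF : \forall x \near x0, forall i, partial i f x = F i x.
  by apply: filterS fC => x fx i; have [/@derive_val] := fx i.
have PH : \forall x \near x0, forall i j, partial j (partial i f) x = H i j x.
  (* A second derivative at [x] sees [partial i f] on a whole neighbourhood of [x], hence the
     iterated neighbourhood. *)
  have PF2 := near_join PF.
  near=> x => i j.
  have e : \near x, F i x = partial i f x.
    have : \forall y \near x, forall i, partial i f y = F i y by near: x.
    by apply: filterS => y ->.
  have fx : C2_at f F H x by near: x.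
  have [_ _ /(_ j)[HD _]] := fx i.
  by rewrite /partial -(near_eq_derive _ e); apply: derive_val.
split; last 2 first.
- by apply/rowP => i; rewrite !mxE; exact: (nbhs_singleton PF).
- by apply/matrixP => i j; rewrite !mxE; exact: (nbhs_singleton PH).
have PF2 := near_join PF; have PH2 := near_join PH.
near=> x => i.
have pf : \forall y \near x, forall i, partial i f y = F i y by near: x.
have ph : \forall y \near x, forall i j, partial j (partial i f) y = H i j y.
  by near: x.
have fx : C2_at f F H x by near: x.
have [[fd fE] Fc FH] := fx i.
split; first split=> //.
- have e : {near x, F i =1 partial i f} by apply: filterS pf => y ->.
  exact: near_eq_continuous_at Fc.
- move=> j; have [[Fd FE] Hc] := FH j.
  split.
    by apply: near_eq_derivable Fd; apply: filterS pf => y ->.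
  have e : {near x, H i j =1 partial j (partial i f)}.
    by apply: filterS ph => y ->.
  exact: near_eq_continuous_at Hc.
Unshelve. all: by end_near. Qed.

Lemma C2_nearP f x0 : C2_near f x0 ->
  C2_with f (fun i => partial i f) (fun i j => partial j (partial i f)) x0.
Proof.
apply: filterS => x fx i; have [[fd fc] fH] := fx i; split.
- by split.
- exact: fc.
- by move=> j; have [fd2 fc2] := fH j; split; [split|exact: fc2].
Qed.

Lemma C2_with_lin f g F H F' H' x0 (a b : R) :
  C2_with f F H x0 -> C2_with g F' H' x0 ->
  C2_with (fun x => a * f x + b * g x)
    (fun i x => a * F i x + b * F' i x)
    (fun i j x => a * H i j x + b * H' i j x) x0.
Proof.
move=> fC gC; near=> x => i.
have fx : C2_at f F H x by near: x.
have gx : C2_at g F' H' x by near: x.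
have [fd fc fH] := fx i; have [gd gc gH] := gx i.
have D (u w : 'rV[R]_n -> R) (du dw : R) v :
    is_derive x v u du -> is_derive x v w dw ->
    is_derive x v (fun x => a * u x + b * w x) (a * du + b * dw).
  move=> ud wd.
  exact: (@is_deriveD _ _ _ (fun x => a *: u x) (fun x => b *: w x) x v).
have C (u w : 'rV[R]_n -> R) : {for x, continuous u} ->
    {for x, continuous w} ->
    {for x, continuous (fun x => a * u x + b * w x)}.
  move=> uc wc; apply: continuousD; apply: continuousM => //; exact: cst_continuous.
split; [exact: D | exact: C |] => j.
have [fjd fjc] := fH j; have [gjd gjc] := gH j.
by split; [exact: D | exact: C].
Unshelve. all: by end_near. Qed.

Lemma C2_with_cst (a : R) x0 :
  C2_with (fun=> a) (fun _ _ => 0) (fun _ _ _ => 0) x0.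
Proof.
apply: (@nearW _ (nbhs x0)) => x i; split; first exact: is_derive_cst.
  exact: cst_continuous.
by move=> j; split; [exact: is_derive_cst| exact: cst_continuous].
Qed.

Lemma is_derive_coord x v i :
  is_derive x v (fun x : 'rV[R]_n => x 0 i) (v 0 i).
Proof.
apply: line_is_derive.
have -> : (fun s : R => (x + s *: v) 0 i) = cst (x 0 i) + v 0 i \*: id.
  by apply/funext => s; rewrite !mxE mulrC.
apply: is_derive_eq; rewrite add0r; exact: mulr1.
Qed.

Definition sqdist (z x : 'rV[R]_n) : R := dotv (x - z) (x - z).

Lemma continuous_coordB z i : continuous (fun x => (x - z) 0 i).
Proof.
have -> : (fun x => (x - z) 0 i) = (fun x => x 0 i) - cst (z 0 i).
  by apply/funext => y; rewrite !mxE.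
by move=> x; apply: continuousB; [exact: coord_continuous|exact: cst_continuous].
Qed.

Lemma continuous_sqdist z : continuous (sqdist z).
Proof.
apply: continuous_big => [|i _]; first exact: add_continuous.
by move=> x; exact: (continuousM (@continuous_coordB z i x) (@continuous_coordB z i x)).
Qed.

Lemma is_derive_sqdist z x v : is_derive x v (sqdist z) (2 * dotv (x - z) v).
Proof.
have -> : sqdist z = \sum_(i < n) ((fun x => x 0 i) - cst (z 0 i)) ^+ 2.
  by apply/funext => y; rewrite fct_sumE; apply: eq_bigr => i _; rewrite !mxE.
apply: is_derive_eq.
  apply: is_derive_sum => i; apply: is_deriveX.
  by apply: is_deriveB; exact: is_derive_coord.
rewrite mulr_sumr; apply: eq_bigr => i _; rewrite !mxE subr0.
by rewrite expr1 /GRing.scale/= !fctE mulr2n; ring.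
Qed.

Lemma dotv_delta x i : dotv x (delta_mx 0 i) = x 0 i.
Proof.
rewrite /dotv (bigD1 i)//= !mxE !eqxx mulr1 big1 ?addr0// => j ji.
by rewrite !mxE (negbTE ji) andbF mulr0.
Qed.

(** Profiles are taken in the squared distance, which is smooth at the centre too; one rule then
    serves the quartic, the paraboloid and, off its vertex, the exponential cone. *)
Lemma C2_with_radial (h h1 h2 : R -> R) z x0 :
  (\forall t \near sqdist z x0, [/\ is_derive (t : R) (1 : R) h (h1 t),
     is_derive (t : R) (1 : R) h1 (h2 t) & {for t, continuous h2}]) ->
  C2_with (h \o sqdist z) (fun i x => 2 * h1 (sqdist z x) * (x - z) 0 i)
   (fun i j x => 4 * h2 (sqdist z x) * (x - z) 0 i * (x - z) 0 j +
                 2 * h1 (sqdist z x) * (i == j)%:R) x0.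
Proof.
move=> hP; have := @continuous_sqdist z x0 _ hP.
apply: (@filterS _ (nbhs x0)) => x /= [hd h1d h2c] i.
have h1c : {for sqdist z x, continuous h1}.
  by apply: differentiable_continuous; apply/derivable1_diffP; case: h1d.
have sc := @continuous_sqdist z x.
have cc k := @continuous_coordB z k x.
have cd k v : is_derive x v (fun x => (x - z) 0 k) (v 0 k).
  have -> : (fun x => (x - z) 0 k) = (fun x => x 0 k) - cst (z 0 k).
    by apply/funext => y; rewrite !mxE.
  apply: is_derive_eq; last exact: subr0.
  by apply: is_deriveB; exact: is_derive_coord.
have cM (u w : 'rV[R]_n -> R) : {for x, continuous u} ->
    {for x, continuous w} -> {for x, continuous (fun x => u x * w x)}.
  by move=> uc wc; exact: continuousM.
have comc (k : R -> R) : {for sqdist z x, continuous k} ->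
    {for x, continuous (k \o sqdist z)} by exact: continuous_comp.
split.
- apply: is_derive_eq; first exact: (is_derive_comp hd (is_derive_sqdist _ _ _)).
  by rewrite dotv_delta; ring.
- by apply: (cM _ _); [apply: (cM _ _); [exact: cst_continuous|exact: (comc _)] | exact: (cc _)].
move=> j; split.
- have -> : (fun x => 2 * h1 (sqdist z x) * (x - z) 0 i) =
            2 \*: (h1 \o sqdist z) * (fun x => (x - z) 0 i).
    by apply/funext => y.
  have d1 := is_derive_comp h1d (is_derive_sqdist z x (delta_mx 0 j)).
  have d2 := cd i (delta_mx 0 j).
  apply: is_derive_eq.
  rewrite dotv_delta !mxE eqxx /= /GRing.scale /=.
  by ring.
- apply: (@continuousD _ _ _ (fun x => _) (fun x => _)).
    apply: (cM _ _); last exact: (cc _).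
    apply: (cM _ _); last exact: (cc _).
    by apply: (cM _ _); [exact: cst_continuous|exact: (comc _)].
  apply: (cM _ _); last exact: cst_continuous.
  by apply: (cM _ _); [exact: cst_continuous|exact: (comc _)].
Qed.

End Calculus.

(** * Differentiability from continuous partial derivatives, and second-order conditions at a
    minimum *)

Section SecondOrder.
Context {R : realType} {n : nat}.
Implicit Types (f g : 'rV[R]_n -> R) (x y v : 'rV[R]_n).

Lemma nbhs_rVP y (P : set 'rV[R]_n) : nbhs y P <->
  exists2 e : R, 0 < e & forall w : 'rV[R]_n,
    (forall j, `|w 0 j - y 0 j| < e) -> P w.
Proof.
split.
  move=> /nbhs_ballP[e /= e0 yP]; exists e => // w we; apply: yP; split=> //.
  by move=> i j; change (`|y i j - w i j| < e); rewrite ord1 distrC; exact: we.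
move=> [e e0 yP]; apply/nbhs_ballP; exists e => // w [_ yw]; apply: yP => j.
by rewrite distrC; exact: yw.
Qed.

Lemma is_derive_scaledir f x v (a df : R) t :
  is_derive (x + (t * a) *: v) v f df ->
  is_derive t (1 : R) (fun s : R => f (x + (s * a) *: v)) (a * df).
Proof.
move=> fd; rewrite mulrC.
apply: (@is_derive1_comp R (fun r : R => f (x + r *: v)) (fun s : R => s * a)).
  exact: is_derive_line.
have -> : (fun s : R => s * a) = a \*: id by apply/funext => s; rewrite mulrC.
apply: is_derive_eq; exact: mulr1.
Qed.

(* Differentiability from continuous partial derivatives: move from [y] to
   [y + v] one coordinate at a time, applying the mean value theorem on each
   segment. *)
Lemma partials_frechet f (F : 'I_n -> 'rV[R]_n -> R) y :
  (\forall x \near y, forall i, is_derive x (delta_mx 0 i) f (F i x)) ->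
  (forall i, {for y, continuous (F i)}) ->
  forall e, 0 < e -> exists2 d, 0 < d & forall v : 'rV[R]_n,
    (forall j, `|v 0 j| < d) ->
    `|f (y + v) - f y - \sum_i v 0 i * F i y| <= e * \sum_i `|v 0 i|.
Proof.
move=> fd Fc e e0.
have Fn : \forall w \near y, forall i, `|F i w - F i y| <= e.
  apply: (@filter_forall _ _ (fun i w => `|F i w - F i y| <= e) (nbhs y) _) => i.
  have /cvgrPdist_le/(_ _ e0) := Fc i.
  by apply: filterS => w /=; rewrite distrC.
have [d d0 dP] := iffLR (nbhs_rVP _ _) (filterI fd Fn).
exists d => // v vd.
pose vk (k : nat) : 'rV[R]_n := \row_j (if (j < k)%N then v 0 j else 0).
have main k : (k <= n)%N ->
    `|f (y + vk k) - f y - \sum_(i < n | (i < k)%N) v 0 i * F i y| <=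
    e * \sum_(i < n | (i < k)%N) `|v 0 i|.
  elim: k => [_|k IH kn].
    rewrite !big_pred0// (_ : vk 0 = 0); last by apply/rowP => j; rewrite !mxE.
    by rewrite addr0 subrr subr0 normr0 mulr0.
  pose i := Ordinal kn.
  have sumE (G : 'I_n -> R) : \sum_(j < n | (j < k.+1)%N) G j =
      G i + \sum_(j < n | (j < k)%N) G j.
    rewrite (bigD1 i)//=; congr (_ + _); apply: eq_bigl => j.
    by rewrite ltnS andbC -val_eqE /= ltn_neqAle.
  rewrite !sumE.
  pose w (s : R) := y + vk k + (s * v 0 i) *: delta_mx 0 i.
  have w1 : y + vk k.+1 = w 1.
    rewrite /w mul1r -addrA; congr (_ + _).
    apply/rowP => j; rewrite !mxE /= ltnS leq_eqVlt.
    case: (eqVneq j i) => [->|ji] /=; first by rewrite eqxx ltnn mulr1 add0r.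
    by rewrite mulr0 addr0 (_ : (j == k :> nat) = false)//; apply/negbTE.
  have wd s : s \in `[0, 1]%R -> forall j, `|w s 0 j - y 0 j| < d.
    rewrite in_itv /= => /andP[s0 s1] j; apply: le_lt_trans (vd j).
    have addK3 (a b c : R) : a + b + c - a = b + c by ring.
    rewrite !mxE /= addK3.
    case: (eqVneq j i) => [->|ji] /=.
      by rewrite ltnn add0r mulr1 normrM (ger0_norm s0) ler_piMl.
    by rewrite mulr0 addr0; case: ifP => _; rewrite ?normr0.
  have dw s : s \in `[0, 1]%R -> forall i, is_derive (w s) (delta_mx 0 i) f (F i (w s)).
    by move=> /wd/dP[].
  have Fw s : s \in `[0, 1]%R -> forall i, `|F i (w s) - F i y| <= e.
    by move=> /wd/dP[].
  have fwd s : s \in `[0, 1]%R -> is_derive (s : R) (1 : R) (f \o w) (v 0 i * F i (w s)).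
    move=> /dw/(_ i) dws; exact: is_derive_scaledir.
  have fwd1 (s : R) : s \in `]0, 1[%R -> is_derive s (1 : R) (f \o w) (v 0 i * F i (w s)).
    by move=> s01; apply: fwd; move: s01; rewrite !in_itv/= => /andP[a b]; rewrite !ltW.
  have fwc : {within `[0, 1], continuous (f \o w)}.
    apply: derivable_within_continuous => s /fwd sd.
    exact: ex_derive.
  have [c c01 cE] := MVT_segment ler01 fwd1 fwc.
  have w0 : w 0 = y + vk k by rewrite /w mul0r scale0r addr0.
  move: cE; rewrite /= -w1 w0 subr0 mulr1 => cE.
  have -> : f (y + vk k.+1) - f y -
      (v 0 i * F i y + \sum_(j < n | (j < k)%N) v 0 j * F j y) =
      v 0 i * (F i (w c) - F i y) + (f (y + vk k) - f y -
      \sum_(j < n | (j < k)%N) v 0 j * F j y).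
    rewrite -[f (y + vk k.+1)](subrK (f (y + vk k))) cE; ring.
  apply: (le_trans (ler_normD _ _)).
  rewrite [leRHS]mulrDr lerD//; last exact: IH (ltnW kn).
  rewrite normrM mulrC ler_wpM2r//; exact: Fw.
have := main n (leqnn n).
have -> : vk n = v by apply/rowP => j; rewrite mxE ltn_ord.
have sumn (G : 'I_n -> R) : \sum_(j < n | (j < n)%N) G j = \sum_j G j.
  by apply: eq_bigl => j; rewrite ltn_ord.
by rewrite !sumn.
Qed.

Lemma partials_is_derive f (F : 'I_n -> 'rV[R]_n -> R) y v :
  (\forall x \near y, forall i, is_derive x (delta_mx 0 i) f (F i x)) ->
  (forall i, {for y, continuous (F i)}) ->
  is_derive y v f (\sum_i v 0 i * F i y).
Proof.
move=> fd Fc; apply: line_is_derive.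
have cv : h^-1 *: (f (y + (h *: 1 + 0) *: v) - f (y + 0 *: v)) @[h --> (0:R)^']
    --> \sum_i v 0 i * F i y.
  apply/cvgrPdist_le => /= e e0.
  pose S := 1 + \sum_i `|v 0 i|.
  have S0 : 0 < S by rewrite ltr_pwDl// sumr_ge0.
  have [d d0 dP] := partials_frechet fd Fc (divr_gt0 e0 S0).
  have hd : \forall h \near (0 : R)^', `|h| < d / S.
    by apply: (nbhs_dnbhs (nbhs0_lt _)); rewrite divr_gt0.
  near=> h.
  have h0 : h != 0 by near: h; exact: nbhs_dnbhs_neq.
  have hdS : `|h| < d / S by near: h.
  have -> : h *: (1 : R) + 0 = h by rewrite addr0; exact: mulr1.
  rewrite scale0r addr0.
  have hm : `|f (y + h *: v) - f y - h * \sum_i v 0 i * F i y| <= `|h| * e.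
    have := dP (h *: v) _.
    have -> : \sum_i (h *: v) 0 i * F i y = h * \sum_i v 0 i * F i y.
      by rewrite mulr_sumr; apply: eq_bigr => i _; rewrite mxE mulrA.
    move=> H; apply: (le_trans (H _)).
      move=> j; rewrite mxE normrM; apply: (@le_lt_trans _ _ (`|h| * S)).
        by rewrite ler_wpM2l// /S (bigD1 j)//= addrCA lerDl addr_ge0// sumr_ge0.
      by rewrite -ltr_pdivlMr.
    have -> : \sum_i `|(h *: v) 0 i| = `|h| * \sum_i `|v 0 i|.
      by rewrite mulr_sumr; apply: eq_bigr => i _; rewrite mxE normrM.
    rewrite mulrCA ler_wpM2l// mulrAC ler_pdivrMr// ler_wpM2l ?(ltW e0)//.
    by rewrite lerDr.
  rewrite distrC -[X in _ - X](mulKf h0) -mulrBr normrM normfV.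
  by rewrite ler_pdivrMl ?normr_gt0.
split; first exact: (cvgP _ cv).
exact: (cvg_lim _ cv).
Unshelve. all: by end_near. Qed.

Lemma partials_continuous f (F : 'I_n -> 'rV[R]_n -> R) y :
  (\forall x \near y, forall i, is_derive x (delta_mx 0 i) f (F i x)) ->
  (forall i, {for y, continuous (F i)}) -> {for y, continuous f}.
Proof.
move=> fd Fc; have [d d0 dP] := partials_frechet fd Fc ltr01.
apply: (iffRL (@cvgrPdist_lt _ _ _ (nbhs y) _ f (f y))) => e e0.
pose K := 1 + \sum_i (`|F i y| + 1).
have K0 : 0 < K by rewrite ltr_pwDl// sumr_ge0// => i _; rewrite addr_ge0.
apply/nbhs_rVP; exists (Num.min d (e / K)); first by rewrite lt_min d0 divr_gt0.
move=> w wy.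
have wd j : `|(w - y) 0 j| < d by have := wy j; rewrite lt_min !mxE => /andP[].
have we j : `|(w - y) 0 j| <= e / K.
  by have := wy j; rewrite lt_min !mxE => /andP[_ /ltW].
have := dP _ wd; rewrite [y + _]addrC subrK mul1r => H.
rewrite distrC -[X in `|X|](subrK (\sum_i (w - y) 0 i * F i y)).
apply: (le_lt_trans (ler_normD _ _)).
apply: (@le_lt_trans _ _ (\sum_i e / K * (`|F i y| + 1))).
  apply: (le_trans (lerD H (ler_norm_sum _ _ _))); rewrite -big_split /=.
  apply: ler_sum => i _; rewrite normrM.
  rewrite (_ : _ + _ = `|(w - y) 0 i| * (`|F i y| + 1)); last by ring.
  by rewrite ler_wpM2r ?addr_ge0.
by rewrite -mulr_sumr mulrAC ltr_pdivrMr// ltr_pM2l// /K ltrDr.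
Qed.

(** [m1] is differentiable at 0 only. If [m2] were negative, [m1] would be negative just to the
    right of 0, and the mean value theorem would give [m t < m 0] there. *)
Lemma second_derivative_test (m m1 : R -> R) (m2 : R) :
  (\forall t \near (0 : R), is_derive t (1 : R) m (m1 t)) ->
  is_derive (0 : R) (1 : R) m1 m2 ->
  (\forall t \near (0 : R), m 0 <= m t) ->
  m1 0 = 0 /\ 0 <= m2.
Proof.
move=> md [m1d m1E] mmin.
have [e /= e0 eP] := (iffLR (nbhs_ballP _ _) (filterI md mmin)).
have eP1 t : `|t| < e -> is_derive t (1 : R) m (m1 t) /\ m 0 <= m t.
  by move=> te; apply: eP; rewrite /ball /= sub0r normrN.
have m10 : m1 0 = 0.
  have : is_derive (0 : R) (1 : R) m 0.
    apply: (@derive1_at_min _ _ (- e) e).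
    - by rewrite ge0_cp ?ltW.
    - by move=> t; rewrite in_itv/= -ltr_norml => /eP1[[]].
    - by rewrite in_itv/= -ltr_norml normr0.
    - by move=> t; rewrite in_itv/= -ltr_norml => /eP1[].
  have [] := eP1 0 _; first by rewrite normr0.
  by move=> [_ <-] _ [_ ->].
split => //; rewrite leNgt; apply/negP => m20.
have cv : h^-1 *: (m1 (h *: 1 + 0) - m1 0) @[h --> (0:R)^'] --> m2.
  by rewrite -m1E; exact: m1d.
have m2n : 0 < - m2 by rewrite oppr_gt0.
have /nbhs_ballP[d /= d0 dP] : \forall h \near (0 : R), h != 0 -> h^-1 * m1 h < 0.
  move: cv => /cvgrPdist_lt/(_ _ m2n); rewrite near_withinE.
  apply: filterS => h /[apply].
  have -> : h *: (1 : R) + 0 = h by rewrite addr0; exact: mulr1.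
  rewrite m10 subr0 => H.
  have {}H : `|m2 - h^-1 * m1 h| < - m2 by exact: H.
  by move: H; rewrite ltr_norml => /andP[]; lra.
pose t := Num.min d e / 2.
have t0 : 0 < t by rewrite divr_gt0// lt_min d0.
have tde : t < Num.min d e by rewrite ltr_pdivrMr// ltr_pMr ?ltr1n// lt_min d0.
have td : t < d by apply: lt_le_trans tde _; rewrite ge_min lexx.
have te : t < e by apply: lt_le_trans tde _; rewrite ge_min lexx orbT.
have [c] : exists2 c, c \in `]0, t[%R & m t - m 0 = m1 c * (t - 0).
  apply: MVT => //.
    move=> x; rewrite in_itv/= => /andP[x0 xt].
    by case: (eP1 x) => //; rewrite gtr0_norm// (lt_trans xt).
  apply: derivable_within_continuous => x.
  rewrite in_itv/= => /andP[x0 xt].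
  by case: (eP1 x) => [|[]//]; rewrite ger0_norm// (le_lt_trans xt).
rewrite in_itv/= subr0 => /andP[c0 ct] mt.
have : m 0 <= m t by case: (eP1 t) => //; rewrite gtr0_norm.
rewrite -subr_ge0 mt pmulr_lge0// leNgt => /negP; apply.
have := dP c; rewrite /ball /= sub0r normrN gtr0_norm// => /(_ (lt_trans ct td)).
by rewrite gt_eqF// => /(_ isT); rewrite pmulr_rlt0// invr_gt0.
Qed.

(** Each direction reduces to one variable by restriction to a line; the partial derivatives are
    then read off on coordinate directions. *)
Lemma C2_local_min f F H x0 : C2_with f F H x0 ->
  (\forall x \near x0, f x0 <= f x) ->
  (forall i, F i x0 = 0) /\
  forall v, 0 <= \sum_i v 0 i * \sum_j v 0 j * H i j x0.
Proof.
move=> fC fmin.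
have cont v : (x0 + t *: v @[t --> (0:R)]) --> x0.
  rewrite -[X in _ --> X]addr0 -[X in _ + X](scale0r v).
  apply: cvgD; first exact: cvg_cst.
  by exact: cvgZr_tmp.
have dF x v : C2_with f F H x -> is_derive x v f (\sum_i v 0 i * F i x).
  move=> fx; apply: partials_is_derive.
    by apply: filterS fx => y fy i; have [] := fy i.
  by move=> i; have [] := nbhs_singleton fx i.
have dH x i v : C2_with f F H x -> is_derive x v (F i) (\sum_j v 0 j * H i j x).
  move=> fx; apply: partials_is_derive.
    by apply: filterS fx => y fy j; have [_ _ /(_ j)[]] := fy i.
  by move=> j; have [_ _ /(_ j)[]] := nbhs_singleton fx i.
have test v : \sum_i v 0 i * F i x0 = 0 /\
    0 <= \sum_i v 0 i * \sum_j v 0 j * H i j x0.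
  have [] := @second_derivative_test (fun t => f (x0 + t *: v))
    (fun t => \sum_i v 0 i * F i (x0 + t *: v)) (\sum_i v 0 i * \sum_j v 0 j * H i j x0).
  - have := cont v _ (near_join fC).
    apply: (@filterS _ (nbhs (0:R))) => t /= Ct.
    by apply: is_derive_line; exact: dF.
  - rewrite (_ : (fun t => _) = \sum_i (v 0 i \*: (fun t => F i (x0 + t *: v)))).
      apply: is_derive_sum => i; apply: is_deriveZ; apply: is_derive_line.
      by rewrite scale0r addr0; exact: dH.
    by apply/funext => t; rewrite fct_sumE.
  - have := cont v _ fmin.
    by apply: (@filterS _ (nbhs (0:R))) => t /=; rewrite scale0r addr0.
  by rewrite scale0r addr0.
split=> [i|v]; last by have [] := test v.
have [+ _] := test (delta_mx 0 i).
rewrite (bigD1 i)//= mxE !eqxx mul1r big1 ?addr0// => j ji.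
by rewrite mxE (negbTE ji) andbF mul0r.
Qed.

End SecondOrder.

(** * The operator as a function of gradient and Hessian *)

Section Euclidean.
Context {R : realType} {n : nat}.
Implicit Types (p x y : 'rV[R]_n) (a : R).

Lemma dotvv_ge0 x : 0 <= dotv x x.
Proof. by apply: sumr_ge0 => i _; rewrite -expr2 sqr_ge0. Qed.

Lemma enorm_ge0 x : 0 <= enorm x. Proof. exact: sqrtr_ge0. Qed.

Lemma sqr_enorm x : enorm x ^+ 2 = dotv x x.
Proof. by rewrite sqr_sqrtr// dotvv_ge0. Qed.

Lemma coord_le_enorm x i : `|x 0 i| <= enorm x.
Proof.
rewrite -(@ler_pXn2r _ 2)// ?nnegrE ?enorm_ge0// sqr_enorm /dotv (bigD1 i)//=.
rewrite real_normK ?num_real// expr2 lerDl.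
by apply: sumr_ge0 => j _; rewrite -expr2 sqr_ge0.
Qed.

Lemma dotvZ a x y : dotv (a *: x) (a *: y) = a ^+ 2 * dotv x y.
Proof. by rewrite /dotv mulr_sumr; apply: eq_bigr => i _; rewrite !mxE; ring. Qed.

Lemma enormZ a x : enorm (a *: x) = `|a| * enorm x.
Proof. by rewrite /enorm dotvZ sqrtrM ?sqr_ge0// sqrtr_sqr. Qed.

Lemma enormN x : enorm (- x) = enorm x.
Proof. by rewrite -scaleN1r enormZ normrN1 mul1r. Qed.

Lemma enorm0 : enorm (0 : 'rV[R]_n) = 0.
Proof. by rewrite -(scale0r 0) enormZ normr0 mul0r. Qed.

Lemma enorm_eq0 x : (enorm x == 0) = (x == 0).
Proof.
apply/eqP/eqP => [x0|->]; last exact: enorm0.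
apply/rowP => i; rewrite mxE; apply/eqP; rewrite -normr_eq0 eq_le normr_ge0 andbT.
by rewrite -x0 coord_le_enorm.
Qed.

Lemma enorm_gt0 x : (0 < enorm x) = (x != 0).
Proof. by rewrite lt_def enorm_eq0 enorm_ge0 andbT. Qed.

(** The l1 norm: it bounds scalar products coordinate by coordinate, and any finite bound on the
    drift suffices. *)
Definition norm1 x : R := \sum_i `|x 0 i|.

Lemma norm_dotv_le x p : `|dotv x p| <= norm1 x * enorm p.
Proof.
rewrite /norm1 mulr_suml; apply: (le_trans (ler_norm_sum _ _ _)).
by apply: ler_sum => i _; rewrite normrM ler_wpM2l// coord_le_enorm.
Qed.

Lemma dotvN x p : dotv x (- p) = - dotv x p.
Proof. by rewrite /dotv -sumrN; apply: eq_bigr => i _; rewrite mxE mulrN. Qed.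

Lemma dotvZr x a p : dotv x (a *: p) = a * dotv x p.
Proof. by rewrite /dotv mulr_sumr; apply: eq_bigr => i _; rewrite mxE mulrCA. Qed.

End Euclidean.

Section Quadratic.
Context {R : realType} {n : nat}.
Implicit Types (p xi : 'rV[R]_n) (X Y : 'M[R]_n) (a : R).

Definition quad X xi : R := dotv xi (xi *m X^T).

Definition mxnorm1 X : R := \sum_i \sum_j `|X i j|.

Lemma quadE X xi : quad X xi = \sum_i xi 0 i * \sum_j xi 0 j * X i j.
Proof.
by apply: eq_bigr => i _; rewrite !mxE; congr (_ * _); apply: eq_bigr => j _;
  rewrite !mxE.
Qed.

Lemma quadZl a X xi : quad (a *: X) xi = a * quad X xi.
Proof.
rewrite !quadE mulr_sumr; apply: eq_bigr => i _; rewrite mulrCA; congr (_ * _).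
by rewrite mulr_sumr; apply: eq_bigr => j _; rewrite !mxE; ring.
Qed.

Lemma quadZr a X xi : quad X (a *: xi) = a ^+ 2 * quad X xi.
Proof.
rewrite !quadE mulr_sumr; apply: eq_bigr => i _; rewrite !mxE.
have -> : \sum_j (a *: xi) 0 j * X i j = a * \sum_j xi 0 j * X i j.
  by rewrite mulr_sumr; apply: eq_bigr => j _; rewrite !mxE mulrA.
by ring.
Qed.

Lemma quadB X Y xi : quad (X - Y) xi = quad X xi - quad Y xi.
Proof.
rewrite !quadE -sumrB; apply: eq_bigr => i _; rewrite -mulrBr; congr (_ * _).
by rewrite -sumrB; apply: eq_bigr => j _; rewrite !mxE; ring.
Qed.

Lemma quadN X xi : quad (- X) xi = - quad X xi.
Proof. by rewrite -scaleN1r quadZl mulN1r. Qed.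

Lemma quad_le X xi : `|quad X xi| <= mxnorm1 X * enorm xi ^+ 2.
Proof.
rewrite quadE /mxnorm1 mulr_suml; apply: (le_trans (ler_norm_sum _ _ _)).
apply: ler_sum => i _; rewrite normrM mulr_suml.
apply: (@le_trans _ _ (enorm xi * \sum_j enorm xi * `|X i j|)).
  apply: ler_pM => //; first exact: coord_le_enorm.
  apply: (le_trans (ler_norm_sum _ _ _)); apply: ler_sum => j _.
  by rewrite normrM ler_wpM2r// coord_le_enorm.
rewrite mulr_sumr; apply: ler_sum => j _.
by rewrite (_ : enorm xi * _ = `|X i j| * enorm xi ^+ 2)//; ring.
Qed.

Lemma norm_quad_sphere X xi : enorm xi = 1 -> `|quad X xi| <= mxnorm1 X.
Proof. by move=> xi1; have := quad_le X xi; rewrite xi1 expr1n mulr1. Qed.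

Lemma min_quad_le X xi : enorm xi = 1 -> min_quad X <= quad X xi.
Proof.
move=> xi1; apply: ge_inf; last by exists xi.
exists (- mxnorm1 X) => _ [z z1 <-]; have := norm_quad_sphere X z1.
by rewrite ler_norml => /andP[].
Qed.

(** With [FopN] and [GopN], this sign symmetry lets facts on maxima and subsolutions be exchanged
    with facts on minima and supersolutions. *)
Lemma max_quadN X : max_quad (- X) = - min_quad X.
Proof.
rewrite /min_quad /inf opprK; congr sup; apply/seteqP; split.
  move=> _ [z z1 <-]; exists (quad X z); first by exists z.
  by rewrite -quadN.
by move=> _ [_ [z z1 <-] <-]; exists z => //; rewrite -/(quad _ _) quadN.
Qed.

Lemma min_quadN X : min_quad (- X) = - max_quad X.
Proof. by rewrite -[X in max_quad X]opprK max_quadN opprK. Qed.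

Lemma le_max_quad X xi : enorm xi = 1 -> quad X xi <= max_quad X.
Proof.
by move=> xi1; rewrite -lerN2 -min_quadN -quadN; exact: min_quad_le.
Qed.

End Quadratic.

Section Operator.
Context {R : realType} {d : nat} (gamma : R).
Hypothesis (gamma_le2 : gamma <= 2).
Implicit Types (p xi : 'rV[R]_d.+1) (X Y : 'M[R]_d.+1) (a : R).

(** The unit sphere is nonempty because the dimension is at least 1; this keeps [sup] and [inf] away
    from their default values. *)
Lemma unit_vector : enorm (delta_mx 0 0 : 'rV[R]_d.+1) = 1.
Proof. by rewrite /enorm dotv_delta mxE !eqxx sqrtr1. Qed.

Lemma le_min_quad a X : (forall xi, enorm xi = 1 -> a <= quad X xi) ->
  a <= min_quad X.
Proof.
move=> aX; apply: lb_le_inf.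
  by exists (quad X (delta_mx 0 0)), (delta_mx 0 0) => //; exact: unit_vector.
by move=> _ [z z1 <-]; exact: aX.
Qed.

Lemma max_quad_le a X : (forall xi, enorm xi = 1 -> quad X xi <= a) ->
  max_quad X <= a.
Proof.
move=> aX; rewrite -lerN2 -min_quadN; apply: le_min_quad => xi xi1.
by rewrite quadN lerN2; exact: aX.
Qed.

Lemma min_le_max_quad X : min_quad X <= max_quad X.
Proof. exact: (le_trans (min_quad_le X unit_vector) (le_max_quad X unit_vector)). Qed.

Lemma min_quadZ a X : 0 < a -> min_quad (a *: X) = a * min_quad X.
Proof.
move=> a0; have H (b : R) Y : 0 < b -> b * min_quad Y <= min_quad (b *: Y).
  move=> b0; apply: le_min_quad => xi xi1.
  by rewrite quadZl ler_pM2l// min_quad_le.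
apply/eqP; rewrite eq_le H// andbT -ler_pdivrMl//.
apply: le_trans (H a^-1 _ _) _; first by rewrite invr_gt0.
by rewrite scalerA mulVf ?gt_eqF// scale1r.
Qed.

Lemma max_quadZ a X : 0 < a -> max_quad (a *: X) = a * max_quad X.
Proof.
move=> a0; rewrite -[X in _ = _ * max_quad X]opprK max_quadN mulrN.
by rewrite -min_quadZ// -max_quadN scalerN opprK.
Qed.

Definition Fop (crit : 'M[R]_d.+1 -> R) p X : R :=
  if p != 0 then enorm p `^ (- gamma) * quad X p
  else if gamma < 2 then 0 else crit X.

Lemma inf_laplacianE crit f x :
  inf_laplacian crit gamma f x = Fop crit (gradient f x) (hessian f x).
Proof.
rewrite /inf_laplacian /Fop; case: ifP => // _; congr (_ * _).
rewrite quadE; apply: eq_bigr => i _; rewrite mulr_sumr; apply: eq_bigr => j _.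
by rewrite !mxE; ring.
Qed.

(** Degenerate ellipticity; at a critical point it survives because both [min_quad] and [max_quad]
    are monotone. *)
Lemma Fop_mono crit p X Y :
  (crit = min_quad \/ crit = max_quad) ->
  (forall xi, quad X xi <= quad Y xi) -> Fop crit p X <= Fop crit p Y.
Proof.
move=> critE XY; rewrite /Fop; case: ifP => _.
  by rewrite ler_wpM2l ?powR_ge0.
case: ifP => // _; case: critE => ->.
  by apply: le_min_quad => xi xi1; exact: le_trans (min_quad_le _ xi1) _.
by apply: max_quad_le => xi xi1; apply: le_trans (XY xi) (le_max_quad _ xi1).
Qed.

Lemma Fop_min_le_max p X : Fop min_quad p X <= Fop max_quad p X.
Proof. by rewrite /Fop; case: ifP => // _; case: ifP => // _; exact: min_le_max_quad. Qed.

Lemma FopN p X : Fop max_quad (- p) (- X) = - Fop min_quad p X.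
Proof.
rewrite /Fop oppr_eq0 enormN max_quadN; case: ifP => _.
  by rewrite -[in quad _ _](scaleN1r p) quadZr quadN; ring.
by case: ifP => //; rewrite oppr0.
Qed.

Lemma Fop0 crit p : crit = min_quad \/ crit = max_quad -> Fop crit p 0 = 0.
Proof.
have q0 xi : quad 0 xi = 0 :> R by rewrite -(scale0r (0 : 'M[R]_d.+1)) quadZl mul0r.
move=> critE; rewrite /Fop q0 mulr0; case: ifP => // _; case: ifP => // _.
case: critE => ->; apply/eqP; rewrite eq_le.
- rewrite le_min_quad ?andbT => [|xi _]; rewrite ?q0//.
  by rewrite -(q0 (delta_mx 0 0)) min_quad_le// unit_vector.
- by rewrite max_quad_le => [|xi _]; rewrite ?q0// -(q0 (delta_mx 0 0)) le_max_quad// unit_vector.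
Qed.

Lemma powR_split (b : R) : 0 < b -> b `^ (2 - gamma) = b `^ (- gamma) * b ^+ 2.
Proof.
move=> b0; rewrite addrC powRD; last by rewrite (gt_eqF b0) implybT.
by rewrite -[2 in X in _ * X]/(2%:R) powR_mulrn// ltW.
Qed.

(** The quadratic form contributes degree 3 and the norm factor degree - gamma. At a critical point
    with gamma = 2 the degree is 1, in agreement with the linear scaling of [crit]. *)
Lemma FopZ crit a p X : crit = min_quad \/ crit = max_quad -> 0 < a ->
  Fop crit (a *: p) (a *: X) = a `^ (3 - gamma) * Fop crit p X.
Proof.
move=> critE a0; rewrite /Fop scaler_eq0 gt_eqF//=; case: ifP => [p0|_].
  rewrite quadZl quadZr enormZ gtr0_norm// powRM ?enorm_ge0 ?(ltW a0)//.
  have -> : 3 - gamma = (2 - gamma) + 1 by ring.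
  rewrite (@powRD _ _ (2 - gamma)); last by rewrite (gt_eqF a0) implybT.
  by rewrite powR_split// powRr1 ?ltW//; ring.
case: ifP => [_|]; first by rewrite mulr0.
move=> /negbT; rewrite -leNgt => g2.
have -> : gamma = 2 by apply/eqP; rewrite eq_le gamma_le2.
have -> : 3 - 2 = 1 :> R by ring.
by rewrite powRr1 ?ltW//; case: critE => ->; rewrite ?min_quadZ ?max_quadZ.
Qed.

(** A bound that stays valid down to zero gradient, where the operator is only defined by
    convention. *)
Lemma Fop_min_ge p X a : (forall xi, - a * enorm xi ^+ 2 <= quad X xi) ->
  - a * enorm p `^ (2 - gamma) <= Fop min_quad p X.
Proof.
move=> aX; rewrite /Fop; case: ifP => [p0|/negbT].
  have ep0 : 0 < enorm p by rewrite enorm_gt0.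
  rewrite powR_split// mulrCA ler_wpM2l ?powR_ge0//; exact: aX.
rewrite negbK => /eqP ->; rewrite enorm0; case: ifP => [g2|/negbT].
  by rewrite powR0 ?mulr0// subr_eq0 gt_eqF.
rewrite -leNgt => g2; have -> : gamma = 2 by apply/eqP; rewrite eq_le gamma_le2.
(* For gamma = 2 the power is 0^0 = 1, so the claim is a bound on [min_quad] over the unit
   sphere. *)
rewrite subrr powRr0 mulr1; apply: le_min_quad => xi xi1.
by have := aX xi; rewrite xi1 expr1n mulr1.
Qed.

End Operator.

(** Away from 0 the power is differentiable. At 0 the radius e^(1/a) is given explicitly, and for a
    = 0 the convention 0^0 = 1 makes the function constant. *)
Lemma powR_norm_continuous (R : realType) (a : R) : 0 <= a ->
  continuous (fun x : R => `|x| `^ a).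
Proof.
move=> a0 x; have [->|x0] := eqVneq x 0; last first.
  apply: (@continuous_comp _ _ _ (fun x : R => `|x|) (fun y => y `^ a)).
    exact: norm_continuous.
  apply: differentiable_continuous; apply/derivable1_diffP.
  by apply: derivable_powR; rewrite in_itv/= andbT normr_gt0.
have [->|an0] := eqVneq a 0.
  have -> : (fun x : R => `|x| `^ 0) = cst 1.
    by apply/funext => y; rewrite powRr0.
  exact: cst_continuous.
have {}a0 : 0 < a by rewrite lt_def an0.
apply/cvgrPdist_lt => /= e e0; rewrite normr0 powR0//.
have d0 : 0 < e `^ a^-1 by exact: powR_gt0.
apply/nbhs_ballP; exists (e `^ a^-1) => // y.
rewrite /ball/= sub0r normrN => yd; rewrite sub0r normrN ger0_norm ?powR_ge0//.
have -> : e = (e `^ a^-1) `^ a by rewrite -powRrM mulVf// powRr1 ?ltW.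
by apply: gt0_ltr_powR; rewrite ?nnegrE ?powR_ge0.
Qed.

(** * Limits of the operator, including at critical points *)

Section Limits.
Context {R : realType} {T : Type} {F : set_system T} {FF : Filter F}.

Lemma cvg_powR_norm (u : T -> R) (u0 a : R) : 0 <= a ->
  u t @[t --> F] --> u0 -> `|u t| `^ a @[t --> F] --> `|u0| `^ a.
Proof.
move=> a0 uu; apply: (@continuous_cvg T R R F FF u (fun x => `|x| `^ a)) => //.
exact: powR_norm_continuous.
Qed.

Lemma cvg_powR_pos (u : T -> R) (u0 a : R) : 0 < u0 ->
  u t @[t --> F] --> u0 -> u t `^ a @[t --> F] --> u0 `^ a.
Proof.
move=> u00 uu; apply: (@continuous_cvg T R R F FF u (fun x => x `^ a)) => //.
apply: differentiable_continuous; apply/derivable1_diffP.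
by apply: derivable_powR; rewrite in_itv/= andbT.
Qed.

Lemma cvg_dotv n (a b : T -> 'rV[R]_n) (a0 b0 : 'rV[R]_n) :
  (forall i, a t 0 i @[t --> F] --> a0 0 i) ->
  (forall i, b t 0 i @[t --> F] --> b0 0 i) ->
  dotv (a t) (b t) @[t --> F] --> dotv a0 b0.
Proof.
move=> ac bc; apply: cvg_big => [|i _]; first exact: add_continuous.
exact: (cvgM (ac i) (bc i)).
Qed.

Lemma cvg_enorm n (p : T -> 'rV[R]_n) (p0 : 'rV[R]_n) :
  (forall i, p t 0 i @[t --> F] --> p0 0 i) ->
  enorm (p t) @[t --> F] --> enorm p0.
Proof. move=> pc; apply: (@continuous_cvg T R R F FF _ Num.sqrt); first exact: sqrt_continuous.
exact: cvg_dotv. Qed.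

Lemma cvg_quad n (X : T -> 'M[R]_n) (X0 : 'M[R]_n)
    (p : T -> 'rV[R]_n) (p0 : 'rV[R]_n) :
  (forall i j, X t i j @[t --> F] --> X0 i j) ->
  (forall i, p t 0 i @[t --> F] --> p0 0 i) ->
  quad (X t) (p t) @[t --> F] --> quad X0 p0.
Proof.
move=> Xc pc; apply: cvg_dotv => // i; rewrite mxE.
under eq_cvg do rewrite mxE.
apply: cvg_big => [|j _]; first exact: add_continuous.
by rewrite mxE; under eq_cvg do rewrite mxE; exact: (cvgM (pc j) (Xc i j)).
Qed.

Lemma cvg_mxnorm1 n (X : T -> 'M[R]_n) (X0 : 'M[R]_n) :
  (forall i j, X t i j @[t --> F] --> X0 i j) ->
  mxnorm1 (X t) @[t --> F] --> mxnorm1 X0.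
Proof.
move=> Xc; apply: cvg_big => [|i _]; first exact: add_continuous.
apply: cvg_big => [|j _]; first exact: add_continuous.
exact: (cvg_norm (Xc i j)).
Qed.

(** Off critical points there is continuity. At a critical point with gamma < 2 the operator is at
    most |X| |p|^(2 - gamma) in size, which tends to 0. With gamma = 2 it is a Rayleigh quotient,
    and only the lower bound by [min_quad X0] minus |X - X0| is available, so semicontinuity is all
    that can hold. *)
Lemma Fop_min_lsc (gamma : R) d (X : T -> 'M[R]_d.+1) (X0 : 'M[R]_d.+1)
    (p : T -> 'rV[R]_d.+1) (p0 : 'rV[R]_d.+1) (e : R) :
  gamma <= 2 ->
  (forall i j, X t i j @[t --> F] --> X0 i j) ->
  (forall i, p t 0 i @[t --> F] --> p0 0 i) -> 0 < e ->
  \forall t \near F, Fop gamma min_quad p0 X0 - e < Fop gamma min_quad (p t) (X t).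
Proof.
move=> gamma_le2 Xc pc e0; have ec := cvg_enorm pc.
have [p00|p00] := eqVneq p0 0; last first.
  have ep0 : 0 < enorm p0 by rewrite enorm_gt0.
  have pne : \forall t \near F, p t != 0.
    have /cvgrPdist_lt/(_ _ ep0) := ec.
    apply: filterS => t; rewrite -enorm_gt0 => H.
    by have := le_lt_trans (ler_norm _) H; rewrite ltrBlDr ltrDl.
  have c : enorm (p t) `^ (- gamma) * quad (X t) (p t) @[t --> F] -->
           enorm p0 `^ (- gamma) * quad X0 p0.
    by apply: cvgM; [exact: cvg_powR_pos|exact: cvg_quad].
  have /cvgrPdist_lt/(_ _ e0) := c.
  apply: filterS2 pne => t pt; rewrite /Fop pt p00 => H.
  by have := le_lt_trans (ler_norm _) H; rewrite ltrBlDr addrC -ltrBlDr.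
have [g2|g2] := ltP gamma 2.
  have -> : Fop gamma min_quad p0 X0 = 0 by rewrite /Fop p00 eqxx g2.
  have c : mxnorm1 (X t) * `|enorm (p t)| `^ (2 - gamma) @[t --> F] -->
           mxnorm1 X0 * `|enorm p0| `^ (2 - gamma).
    apply: cvgM; first exact: cvg_mxnorm1.
    by apply: cvg_powR_norm => //; rewrite subr_ge0.
  move: c; rewrite p00 enorm0 normr0 powR0 ?mulr0; last by rewrite subr_eq0 gt_eqF.
  move=> /cvgrPdist_lt/(_ _ e0); apply: filterS => t.
  rewrite sub0r normrN (ger0_norm (enorm_ge0 _)) => H.
  have H2 := le_lt_trans (ler_norm _) H.
  rewrite sub0r; apply: (@lt_le_trans _ _ (- (mxnorm1 (X t)) * enorm (p t) `^ (2 - gamma))).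
    by rewrite mulNr ltrN2.
  apply: Fop_min_ge => // xi; rewrite mulNr.
  by have := quad_le (X t) xi; rewrite ler_norml => /andP[].
have gE : gamma = 2 by apply/eqP; rewrite eq_le gamma_le2.
have -> : Fop gamma min_quad p0 X0 = min_quad X0.
  by rewrite /Fop p00 eqxx gE ltxx.
have c : mxnorm1 (X t - X0) @[t --> F] --> mxnorm1 (0 : 'M[R]_d.+1).
  apply: cvg_mxnorm1 => i j; rewrite mxE -(subrr (X0 i j)).
  by under eq_cvg do rewrite !mxE; apply: cvgB => //; exact: cvg_cst.
have mx0 : mxnorm1 (0 : 'M[R]_d.+1) = 0.
  by rewrite /mxnorm1 big1// => i _; rewrite big1// => j _; rewrite mxE normr0.
move: c; rewrite mx0 => /cvgrPdist_lt/(_ _ e0); apply: filterS => t.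
rewrite sub0r normrN => H.
have H2 := le_lt_trans (ler_norm _) H.
apply: (@lt_le_trans _ _ (min_quad X0 - mxnorm1 (X t - X0))).
  by rewrite ltrD2l ltrN2.
have := @Fop_min_ge R d gamma gamma_le2 (p t) (X t) (mxnorm1 (X t - X0) - min_quad X0).
rewrite gE subrr powRr0 mulr1 opprB; apply=> xi.
have qd : - mxnorm1 (X t - X0) * enorm xi ^+ 2 <= quad (X t) xi - quad X0 xi.
  by rewrite -quadB mulNr; have := quad_le (X t - X0) xi; rewrite ler_norml => /andP[].
have q0 : min_quad X0 * enorm xi ^+ 2 <= quad X0 xi.
  have [->|xi0] := eqVneq xi 0.
    by rewrite enorm0 expr0n mulr0 -(scale0r (0 : 'rV[R]_d.+1)) quadZr expr0n mul0r.
  have ex : 0 < enorm xi by rewrite enorm_gt0.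
  have := @min_quad_le _ _ X0 ((enorm xi)^-1 *: xi).
  rewrite enormZ gtr0_norm ?invr_gt0// mulVf ?gt_eqF// => /(_ erefl).
  by rewrite quadZr exprVn ler_pdivlMl ?exprn_gt0// mulrC.
by rewrite mulrBl; lra.
Qed.

End Limits.

Section Nonlinearity.
Context {R : realType} {n : nat}.
Variable gamma : R.
Implicit Types (q : 'rV[R]_n -> 'rV[R]_n) (c : 'rV[R]_n -> R) (x p : 'rV[R]_n).

(** The power is taken of [|r|], which makes the family stable under a change of sign of the
    solution and continuous in [r]; for [0 <= r] it agrees with [eigen_G]. [delta] is the source
    term. *)
Definition Gop q c (delta : R) x (r : R) p : R :=
  dotv (q x) p * enorm p `^ (2 - gamma) + c x * `|r| `^ (3 - gamma) + delta.

Lemma GopN q c delta x r p :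
  Gop q (fun x => - c x) (- delta) x (- r) (- p) = - Gop q c delta x r p.
Proof. by rewrite /Gop dotvN enormN normrN; ring. Qed.

Lemma eigen_GE q c lambda x r p : 0 <= r ->
  eigen_G gamma q c lambda x r p = Gop q (fun x => c x + lambda) 0 x r p.
Proof. by move=> r0; rewrite /eigen_G /Gop ger0_norm//; ring. Qed.

Lemma cvg_Gop q c delta (T : Type) (F : set_system T) (FF : Filter F)
    (x : T -> 'rV[R]_n) (x0 : 'rV[R]_n) (r : T -> R) (r0 : R)
    (p : T -> 'rV[R]_n) (p0 : 'rV[R]_n) :
  gamma <= 2 ->
  {for x0, continuous q} -> {for x0, continuous c} ->
  x t @[t --> F] --> x0 -> r t @[t --> F] --> r0 ->
  (forall i, p t 0 i @[t --> F] --> p0 0 i) ->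
  Gop q c delta (x t) (r t) (p t) @[t --> F] --> Gop q c delta x0 r0 p0.
Proof.
move=> g2 qc cc xc rc pc; apply: cvgD; last exact: cvg_cst.
apply: cvgD; apply: cvgM.
- apply: cvg_dotv => // i.
  apply: (@cvg_comp _ _ _ (fun t => q (x t)) (fun y : 'rV[R]_n => y 0 i)).
    exact: (cvg_comp _ _ xc qc).
  exact: coord_continuous.
- have := @cvg_powR_norm R T F FF (enorm \o p) (enorm p0) (2 - gamma).
  rewrite subr_ge0 => /(_ g2 (cvg_enorm pc)); rewrite ger0_norm ?enorm_ge0//.
  by under eq_cvg do rewrite /= ger0_norm ?enorm_ge0//.
- exact: (cvg_comp _ _ xc cc).
- by apply: cvg_powR_norm => //; rewrite subr_ge0 (le_trans g2)// ler_nat.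
Qed.

End Nonlinearity.

(** * Viscosity inequalities at a point *)

(* The gradient and the Hessian are locked because failing matches against them
   would otherwise unfold derivatives down to limits of filters. *)
Definition grad {R : realType} {n : nat} := locked (@gradient R n).
Definition hess {R : realType} {n : nat} := locked (@hessian R n).

(** * Calculus of test functions and their 2-jets *)

Section TestFunctions.
Context {R : realType} {d : nat}.
Local Notation V := 'rV[R]_d.
Implicit Types (f g : V -> R) (x z : V).

Lemma C2_withP f F H x0 : C2_with f F H x0 ->
  [/\ C2_near f x0, grad f x0 = \row_i F i x0 & hess f x0 = \matrix_(i, j) H i j x0].
Proof. by rewrite /grad /hess -!lock; exact: C2_with_jet. Qed.

Lemma gradE f x i : grad f x 0 i = partial i f x.
Proof. by rewrite /grad -lock; exact: mxE. Qed.

Lemma hessE f x i j : hess f x i j = partial j (partial i f) x.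
Proof. by rewrite /hess -lock; exact: mxE. Qed.

Lemma C2_lin f g (a b : R) x0 : C2_near f x0 -> C2_near g x0 ->
  let h x := a * f x + b * g x in
  [/\ C2_near h x0, grad h x0 = a *: grad f x0 + b *: grad g x0 &
      hess h x0 = a *: hess f x0 + b *: hess g x0].
Proof.
move=> /C2_nearP fC /C2_nearP gC h.
have [h1 h2 h3] := C2_withP (C2_with_lin a b fC gC).
have lin m (A B : 'M[R]_(m, d)) i j :
  (a *: A + b *: B) i j = a * A i j + b * B i j by rewrite !mxE.
split; [exact: h1 | apply/rowP => i | apply/matrixP => i j]; rewrite lin.
  by rewrite !gradE -gradE h2 mxE.
by rewrite !hessE -hessE h3 mxE.
Qed.

Lemma C2_cst (a : R) x0 :
  [/\ C2_near (fun=> a : R) x0, grad (fun=> a : R) x0 = 0 &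
      hess (fun=> a : R) x0 = 0].
Proof.
have [h1 h2 h3] := C2_withP (C2_with_cst a x0).
by split; [exact: h1 | rewrite [LHS]h2; apply/rowP => i |
  rewrite [LHS]h3; apply/matrixP => i j]; rewrite !mxE.
Qed.

Lemma C2_affine f (a b : R) x0 : C2_near f x0 ->
  let h x := a * f x + b in
  [/\ C2_near h x0, grad h x0 = a *: grad f x0 &
      hess h x0 = a *: hess f x0].
Proof.
move=> fC h; have [c1 c2 c3] := C2_cst b x0.
have := C2_lin a 1 fC c1; rewrite c2 c3 !scaler0 !addr0 /=.
by rewrite (_ : (fun x => _) = h)//; apply/funext => x; rewrite mul1r.
Qed.

Lemma C2_opp f x0 : C2_near f x0 ->
  let h x := - f x in
  [/\ C2_near h x0, grad h x0 = - grad f x0 &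
      hess h x0 = - hess f x0].
Proof.
move=> fC h; have := C2_affine (-1) 0 fC; rewrite /= !scaleN1r.
by rewrite (_ : (fun x => _) = h)//; apply/funext => x; rewrite mulN1r addr0.
Qed.

Lemma C2_continuous f x0 : C2_near f x0 -> \forall x \near x0, {for x, continuous f}.
Proof.
move=> /C2_nearP/near_join; apply: filterS => x fx.
apply: (@partials_continuous _ _ _ (fun i => partial i f)).
  by apply: filterS fx => y fy i; have [] := fy i.
by move=> i; have [] := nbhs_singleton fx i.
Qed.

Lemma cvg_grad f x0 : C2_near f x0 ->
  forall i, grad f x 0 i @[x --> x0] --> grad f x0 0 i.
Proof.
move=> /nbhs_singleton fx i; rewrite (gradE f x0).
under eq_cvg do rewrite gradE.
by have [[]] := fx i.
Qed.

Lemma cvg_hess f x0 : C2_near f x0 ->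
  forall i j, hess f x i j @[x --> x0] --> hess f x0 i j.
Proof.
move=> /nbhs_singleton fx i j; rewrite (hessE f x0).
under eq_cvg do rewrite hessE.
by have [_ /(_ j)[]] := fx i.
Qed.

(** Its value, gradient and Hessian vanish at [z] and it is positive elsewhere: adding it makes a
    contact strict without changing the jet. *)
Definition quartic z x : R := sqdist z x ^+ 2.

Lemma sqdistxx x : sqdist x x = 0.
Proof.
by rewrite /sqdist subrr /dotv big1// => i _; rewrite mxE mul0r.
Qed.

Lemma quarticxx x : quartic x x = 0.
Proof. by rewrite /quartic sqdistxx expr0n. Qed.

Lemma sqdist_gt0 z x : x != z -> 0 < sqdist z x.
Proof.
rewrite -subr_eq0 -enorm_gt0 => xz; rewrite /sqdist -sqr_enorm.
by rewrite exprn_gt0.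
Qed.

Lemma quartic_gt0 z x : x != z -> 0 < quartic z x.
Proof. by move=> /sqdist_gt0 xz; rewrite exprn_gt0. Qed.

Lemma coord_le_quartic z x i : (x 0 i - z 0 i) ^+ 4 <= quartic z x.
Proof.
rewrite (exprM _ 2 2) ler_pXn2r// ?nnegrE ?sqr_ge0 ?dotvv_ge0//.
rewrite /sqdist -sqr_enorm -real_normK ?num_real// ler_pXn2r// ?nnegrE ?enorm_ge0//.
by have := coord_le_enorm (x - z) i; rewrite !mxE.
Qed.

Lemma C2_with_quartic z x0 : C2_with (quartic z)
  (fun i x => 2 * (2 * sqdist z x) * (x - z) 0 i)
  (fun i j x => 4 * 2 * (x - z) 0 i * (x - z) 0 j +
                2 * (2 * sqdist z x) * (i == j)%:R) x0.
Proof.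
apply: (@C2_with_radial _ _ (fun t : R => t ^+ 2) (fun t => 2 * t) (fun=> 2)).
near=> t; split; last exact: cst_continuous.
- have -> : (fun t : R => t ^+ 2) = id ^+ 2 by apply/funext.
  by apply: is_derive_eq; rewrite /= expr1; exact: mulr1.
- have -> : (fun t : R => 2 * t) = 2 \*: id by apply/funext.
  by apply: is_derive_eq; exact: mulr1.
Unshelve. all: by end_near. Qed.

Lemma C2_quartic z x0 : C2_near (quartic z) x0.
Proof. by have [] := C2_withP (C2_with_quartic z x0). Qed.

Lemma quartic_jet z : grad (quartic z) z = 0 /\ hess (quartic z) z = 0.
Proof.
have [_ h2 h3] := C2_withP (C2_with_quartic z z).
split; [rewrite [LHS]h2; apply/rowP => i|rewrite [LHS]h3; apply/matrixP => i j].
  by rewrite mxE sqdistxx !mulr0 mul0r mxE.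
by rewrite mxE sqdistxx !mulr0 mul0r addr0 subrr !mxE mulr0.
Qed.

Lemma C2_add_quartic f (a b : R) x0 : C2_near f x0 ->
  let h x := f x + b * quartic x0 x + a in
  [/\ C2_near h x0, grad h x0 = grad f x0 &
      hess h x0 = hess f x0].
Proof.
move=> fC h; have [q1 q2] := quartic_jet x0.
have [k1 k2 k3] := C2_lin 1 b fC (C2_quartic x0 x0).
have := C2_affine 1 a k1; rewrite /= k2 k3 q1 q2 !scaler0 !addr0 !scale1r.
by rewrite (_ : (fun x => _) = h)//; apply/funext => x; rewrite !mul1r.
Qed.

End TestFunctions.

Section Viscosity.
Context {R : realType} {d : nat} (gamma : R).
Hypothesis (gamma_le2 : gamma <= 2).
Local Notation V := 'rV[R]_d.+1.
Local Notation Fmax := (Fop gamma max_quad).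
Local Notation Fmin := (Fop gamma min_quad).
Local Notation G := (Gop gamma).
Implicit Types (u w psi f g : V -> R) (x p : V) (q : V -> V) (c : V -> R).

Lemma gradient_grad f x : gradient f x = grad f x.
Proof. by rewrite /grad -lock. Qed.

Lemma inf_laplacian_gradE crit f x :
  inf_laplacian crit gamma f x = Fop gamma crit (grad f x) (hess f x).
Proof. by rewrite /grad /hess -!lock; exact: inf_laplacianE. Qed.

(** Contact may be non-strict, and [psi] may differ from [u] at [x0] by a constant, so an extremum
    of [u - psi] can be used as it stands. A quartic and a constant recover the strict form. *)
Definition sub_at q c (delta : R) u x0 := forall psi, C2_near psi x0 ->
  (\forall x \near x0, u x - u x0 <= psi x - psi x0) ->
  0 <= Fmax (grad psi x0) (hess psi x0)
       + G q c delta x0 (u x0) (grad psi x0).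

Definition super_at q c (delta : R) u x0 := forall psi, C2_near psi x0 ->
  (\forall x \near x0, psi x - psi x0 <= u x - u x0) ->
  Fmin (grad psi x0) (hess psi x0)
       + G q c delta x0 (u x0) (grad psi x0) <= 0.

Lemma super_atP q c delta u x0 :
  super_at q c delta u x0 <->
  sub_at q (fun x => - c x) (- delta) (fun x => - u x) x0.
Proof.
split=> H psi psiC psiu.
- have [h1 h2 h3] := C2_opp psiC.
  have := H _ h1; rewrite h2 h3 => {}H.
  rewrite -[grad psi x0]opprK -[hess psi x0]opprK FopN GopN.
  rewrite -opprD oppr_ge0; apply: H.
  by apply: filterS psiu => x; lra.
- have [h1 h2 h3] := C2_opp psiC.
  have := H _ h1; rewrite h2 h3 FopN GopN -opprD oppr_ge0.
  apply; apply: filterS psiu => x; lra.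
Qed.

Lemma visc_super_at q c delta (Gf : V -> R -> V -> R) (U : set V) u x0 :
  visc_supersolution gamma Gf U u -> U x0 ->
  (forall p, Gf x0 (u x0) p = G q c delta x0 (u x0) p) ->
  super_at q c delta u x0.
Proof.
move=> [_ uS] Ux0 GE psi psiC psiu; rewrite -GE.
have [h1 h2 h3] := C2_add_quartic (u x0 - psi x0) (-1) psiC.
have := uS _ _ Ux0 h1; rewrite inf_laplacian_gradE gradient_grad h2 h3; apply.
  by rewrite quarticxx mulr0 addr0 addrC subrK.
near=> x.
have x0x : x != x0 by near: x; exact: nbhs_dnbhs_neq.
have := quartic_gt0 x0x.
have : psi x - psi x0 <= u x - u x0 by near: x; exact: nbhs_dnbhs.
lra.
Unshelve. all: by end_near. Qed.

Lemma sub_at_visc q c delta (Gf : V -> R -> V -> R) (U : set V) u :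
  continuous u ->
  (forall x p, U x -> Gf x (u x) p = G q c delta x (u x) p) ->
  (forall x, U x -> sub_at q c delta u x) ->
  visc_subsolution gamma Gf U u.
Proof.
move=> uc GE us; split.
  move=> x Ux a uxa; have H : \forall y \near x, u y < a := uc x _ (lt_nbhsl uxa).
  by rewrite near_withinE; apply: filterS H.
move=> x0 psi Ux0 psiC upsi psiu; rewrite inf_laplacian_gradE gradient_grad GE//.
apply: us => //; move: psiu; rewrite near_withinE; apply: filterS => x xP.
rewrite upsi; have [->|/xP] := eqVneq x x0; first by rewrite upsi.
by move=> /ltW; rewrite lerD2r.
Qed.

Lemma super_at_visc q c delta (Gf : V -> R -> V -> R) (U : set V) u :
  {in U, continuous u} ->
  (forall x p, U x -> Gf x (u x) p = G q c delta x (u x) p) ->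
  (forall x, U x -> super_at q c delta u x) ->
  visc_supersolution gamma Gf U u.
Proof.
move=> uc GE us; split.
  move=> x Ux a uxa; have H : \forall y \near x, a < u y := uc x (mem_set Ux) _ (lt_nbhsr uxa).
  by rewrite near_withinE; apply: filterS H.
move=> x0 psi Ux0 psiC upsi psiu; rewrite inf_laplacian_gradE gradient_grad GE//.
apply: us => //; move: psiu; rewrite near_withinE; apply: filterS => x xP.
rewrite upsi; have [->|/xP] := eqVneq x x0; first by rewrite upsi.
by move=> /ltW; rewrite lerD2r.
Qed.

(** A function touching [u] from above at [x0] also touches [w] from above, up to a constant. This
    covers pointwise maxima, added constants and changes of the coefficient. *)
Lemma sub_at_le q c c' delta delta' u w x0 :
  sub_at q c delta w x0 ->
  (\forall x \near x0, w x - w x0 <= u x - u x0) ->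
  (forall p, G q c delta x0 (w x0) p <= G q c' delta' x0 (u x0) p) ->
  sub_at q c' delta' u x0.
Proof.
move=> ws wu GG psi psiC upsi.
apply: le_trans (ws psi psiC _) _; last by rewrite lerD2l.
by apply: filterS2 wu upsi => x; exact: le_trans.
Qed.

Lemma super_at_le q c c' delta delta' u w x0 :
  super_at q c delta w x0 ->
  (\forall x \near x0, u x - u x0 <= w x - w x0) ->
  (forall p, G q c' delta' x0 (u x0) p <= G q c delta x0 (w x0) p) ->
  super_at q c' delta' u x0.
Proof.
move=> ws wu GG psi psiC upsi.
apply: le_trans (ws psi psiC _); first by rewrite lerD2l.
by apply: filterS2 upsi wu => x; exact: le_trans.
Qed.

Lemma GopZ q c delta x (a r : R) p : 0 < a ->
  G q c (a `^ (3 - gamma) * delta) x (a * r) (a *: p) =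
  a `^ (3 - gamma) * G q c delta x r p.
Proof.
move=> a0; rewrite /Gop dotvZr enormZ normrM gtr0_norm//.
rewrite !powRM ?enorm_ge0 ?(ltW a0)//.
have aE : a `^ (3 - gamma) = a * a `^ (2 - gamma).
  have -> : 3 - gamma = 1 + (2 - gamma) by ring.
  rewrite powRD; last by rewrite (gt_eqF a0) implybT.
  by rewrite powRr1// ltW.
by rewrite aE; ring.
Qed.

(** The equation is homogeneous of degree 3 - gamma, so only the source is rescaled; this is what
    normalization uses. *)
Lemma sub_atZ q c delta u x0 (a : R) : 0 < a -> sub_at q c delta u x0 ->
  sub_at q c (a `^ (3 - gamma) * delta) (fun x => a * u x) x0.
Proof.
move=> a0 us psi psiC psiu.
have [h1 h2 h3] := C2_affine a^-1 0 psiC.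
have := us _ h1; rewrite h2 h3 => H.
have pE : grad psi x0 = a *: (a^-1 *: grad psi x0).
  by rewrite scalerA divff ?gt_eqF// scale1r.
have XE : hess psi x0 = a *: (a^-1 *: hess psi x0).
  by rewrite scalerA divff ?gt_eqF// scale1r.
rewrite pE XE GopZ// FopZ//; last by right.
rewrite -mulrDr mulr_ge0 ?powR_ge0//; apply: H.
apply: filterS psiu => x; rewrite !addr0 -!mulrBr => H.
by rewrite ler_pdivlMl.
Qed.

Lemma super_atZ q c delta u x0 (a : R) : 0 < a -> super_at q c delta u x0 ->
  super_at q c (a `^ (3 - gamma) * delta) (fun x => a * u x) x0.
Proof.
move=> a0 /super_atP us; apply/super_atP; rewrite -mulrN.
have -> : (fun x => - (a * u x)) = (fun x => a * - u x).
  by apply/funext => x; rewrite mulrN.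
exact: sub_atZ.
Qed.

(* Degenerate ellipticity: at a contact point the two gradients agree and the
   Hessians are ordered. *)
Lemma classical_sub_at q c delta w x0 : C2_near w x0 ->
  0 <= Fmax (grad w x0) (hess w x0) + G q c delta x0 (w x0) (grad w x0) ->
  sub_at q c delta w x0.
Proof.
move=> wC w0 psi psiC wpsi.
have := C2_local_min (C2_with_lin 1 (-1) (C2_nearP psiC) (C2_nearP wC)).
case.
  by apply: filterS wpsi => x; lra.
move=> gE hE.
have gradE : grad psi x0 = grad w x0.
  by apply/rowP => i; rewrite !gradE; have := gE i; lra.
rewrite gradE; apply: (le_trans w0); rewrite lerD2r.
apply: Fop_mono; first by right.
move=> xi; rewrite -subr_ge0 -quadB quadE; have := hE xi.
congr (0 <= _); apply: eq_bigr => i _; congr (_ * _); apply: eq_bigr => j _.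
have subE (A B : 'M[R]_d.+1) : (A - B) i j = A i j - B i j by rewrite !mxE.
by rewrite subE !hessE mul1r mulN1r.
Qed.

Lemma super_at_cst q c delta (a : R) x0 : c x0 * `|a| `^ (3 - gamma) + delta <= 0 ->
  super_at q c delta (fun=> a) x0.
Proof.
move=> ca; apply/super_atP; have [h1 h2 h3] := C2_cst (- a) x0.
apply: classical_sub_at => //; rewrite h2 h3 Fop0; last by right.
rewrite add0r /Gop normrN /dotv big1 ?mul0r => [|i _]; last by rewrite mxE mulr0.
by rewrite add0r; lra.
Qed.

Lemma sub_at_cst q c delta (a : R) x0 : 0 <= c x0 * `|a| `^ (3 - gamma) + delta ->
  sub_at q c delta (fun=> a) x0.
Proof.
move=> ca; have [h1 h2 h3] := C2_cst a x0.
apply: classical_sub_at => //; rewrite h2 h3 Fop0; last by right.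
rewrite add0r /Gop /dotv big1 ?mul0r => [|i _]; last by rewrite mxE mulr0.
by rewrite add0r.
Qed.

End Viscosity.

(** * Stability of viscosity inequalities under approximation *)

Section Stability.
Context {R : realType} {d : nat} (gamma : R).
Hypothesis (gamma_le2 : gamma <= 2).
Local Notation V := 'rV[R]_d.+1.
Local Notation Fmax := (Fop gamma max_quad).
Local Notation Fmin := (Fop gamma min_quad).
Local Notation G := (Gop gamma).
Implicit Types (u w psi f g : V -> R) (x p : V) (q : V -> V) (c : V -> R).

Lemma compact_box x0 (rho : R) :
  compact [set w : V | forall j, `|w 0 j - x0 0 j| <= rho].
Proof.
have := @rV_compact _ _ (fun j => `[x0 0 j - rho, x0 0 j + rho]%classic)
  (fun j => @segment_compact _ _ _).
congr compact; apply/seteqP; split=> w /= wP j; have := wP j;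
  by rewrite /= in_itv/= ler_distl.
Qed.

(** Lower semicontinuity of [Fmin] is exactly the direction required: the operator and the
    lower-order part each lose at most v0/4, which leaves more than v0/4. *)
Lemma strict_super_open q c delta psi x0 r0 :
  C2_near psi x0 -> {for x0, continuous q} -> {for x0, continuous c} ->
  0 < Fmin (grad psi x0) (hess psi x0) + G q c delta x0 r0 (grad psi x0) ->
  exists2 eta, 0 < eta & \forall x \near x0, forall r, `|r - r0| < eta ->
    eta < Fmin (grad psi x) (hess psi x) + G q c delta x r (grad psi x).
Proof.
move=> psiC qc cc; set v0 := _ + _ => v00.
have e0 : 0 < v0 / 4 by rewrite divr_gt0.
have Fn : \forall x \near x0, Fmin (grad psi x0) (hess psi x0) - v0 / 4 <
    Fmin (grad psi x) (hess psi x).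
  exact: (Fop_min_lsc gamma_le2 (cvg_hess psiC) (cvg_grad psiC) e0).
have Gc : G q c delta z.1 z.2 (grad psi z.1) @[z --> (x0, r0)] -->
    G q c delta x0 r0 (grad psi x0).
  apply: cvg_Gop => //; [exact: cvg_fst|exact: cvg_snd|] => i.
  apply: (@continuous_cvg _ _ _ (nbhs (x0, r0)) _ fst (fun x => grad psi x 0 i)).
    exact: cvg_grad.
  exact: cvg_fst.
have /cvgrPdist_lt/(_ _ e0)[[A B] /= [xA rB] AB] := Gc.
have [e1 /= e10 e1B] := iffLR (nbhs_ballP _ _) rB.
exists (Num.min e1 (v0 / 4)); first by rewrite lt_min e10.
have {}xA : \forall x \near x0, A x by [].
apply: filterS2 Fn xA => x Fx Ax r; rewrite lt_min => /andP[re1 re].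
have := AB (x, r) (conj Ax (e1B r _)); rewrite /ball/= distrC => /(_ re1).
move=> H; have H1 : G q c delta x0 r0 (grad psi x0) - G q c delta x r (grad psi x)
    < v0 / 4 := le_lt_trans (ler_norm _) H.
apply: (@le_lt_trans _ _ (v0 / 4)); first by rewrite ge_min lexx orbT.
have vE : v0 = Fmin (grad psi x0) (hess psi x0) +
  G q c delta x0 r0 (grad psi x0) by [].
by move: H1 Fx v00 vE; lra.
Qed.

Lemma Fmax_opp p X : Fmax p X = - Fmin (- p) (- X).
Proof. by rewrite -FopN !opprK. Qed.

Lemma strict_sub_open q c delta psi x0 r0 :
  C2_near psi x0 -> {for x0, continuous q} -> {for x0, continuous c} ->
  Fmax (grad psi x0) (hess psi x0) + G q c delta x0 r0 (grad psi x0) < 0 ->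
  exists2 eta, 0 < eta & \forall x \near x0, forall r, `|r - r0| < eta ->
    Fmax (grad psi x) (hess psi x) + G q c delta x r (grad psi x) < - eta.
Proof.
move=> psiC qc cc v0.
have [h1 h2 h3] := C2_opp psiC.
have ccN : {for x0, continuous (fun x => - c x)} by exact: continuousN.
have [|eta eta0 H] := @strict_super_open q (fun x => - c x) (- delta) _ x0 (- r0) h1 qc ccN.
  by rewrite h2 h3 GopN -[Fmin _ _]opprK -Fmax_opp -opprD oppr_gt0.
exists eta => //; apply: filterS2 H (near_join psiC) => x H psiCx r rr0.
have [_ g2 g3] := C2_opp psiCx.
have := H (- r); rewrite -opprD normrN => /(_ rr0).
by rewrite g2 g3 GopN -[Fmin _ _]opprK -Fmax_opp -opprD ltrNr.
Qed.

(* [u] is a subsolution at [x0] as soon as it is approximated from below at [x0]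
   and from above everywhere: maxima of [w - psi] converge to the strict contact
   point of [psi] with [u]. *)
Lemma sub_at_stable q c delta (O : set V) u x0 :
  open O -> O x0 -> {for x0, continuous q} -> {for x0, continuous c} ->
  (forall e, 0 < e -> exists (kappa delta' : R) w,
    [/\ `|kappa| <= e, `|delta' - delta| <= e & continuous w] /\
    [/\ forall x, w x <= u x + e, u x0 - e <= w x0 &
        forall x, O x -> sub_at gamma q (fun x => c x + kappa) delta' w x]) ->
  sub_at gamma q c delta u x0.
Proof.
move=> oO Ox0 qc cc happ psi psiC psiu; rewrite leNgt; apply/negP => v0.
have [C2q gq hq] := C2_add_quartic 0 1 psiC.
set phi := (fun x => psi x + 1 * quartic x0 x + 0) in C2q gq hq.
rewrite -gq -hq in v0.
have [eta eta0 etaP] := strict_sub_open C2q qc cc v0.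
have psi_c : {for x0, continuous psi} by exact: nbhs_singleton (C2_continuous psiC).
have eta4 : 0 < eta / 4 by rewrite divr_gt0.
have psi_n : \forall x \near x0, `|psi x0 - psi x| < eta / 4.
  by move: psi_c => /cvgrPdist_lt/(_ _ eta4).
have O_n : \forall x \near x0, O x by exact: open_nbhs_nbhs.
have phi_c := C2_continuous C2q.
have [r0 r00 r0P] := iffLR (nbhs_rVP _ _) (filterI (filterI (filterI etaP psi_n)
   (filterI psiu O_n)) (filterI (near_join C2q) phi_c)).
pose rho := r0 / 2.
have rho0 : 0 < rho by rewrite divr_gt0.
pose K := [set w : V | forall j, `|w 0 j - x0 0 j| <= rho].
have KP (w : V) : K w -> forall j, `|w 0 j - x0 0 j| < r0.
  by move=> Kw j; apply: le_lt_trans (Kw j) _; rewrite /rho; lra.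
(* [B] bounds [|r|^(3-gamma)] near the contact value *)
pose B := (`|u x0| + eta) `^ (3 - gamma) + 1.
have B1 : 1 <= B by rewrite lerDr powR_ge0.
(* The first bound keeps the error caused by [kappa] and [delta'] below eta. The second gives
   [quartic x0 x1 <= 2 * e < rho ^+ 4], which puts the maximum point [x1] in the interior of the
   box. *)
pose e := Num.min (eta / (4 * B)) (rho ^+ 4 / 4).
have e0 : 0 < e.
  by rewrite lt_min !divr_gt0 ?exprn_gt0// mulr_gt0// (lt_le_trans ltr01).
have eB : e * B <= eta / 4.
  have : e <= eta / (4 * B) by rewrite ge_min lexx.
  move=> /(ler_wpM2r (le_trans ler01 B1)) /le_trans; apply.
  rewrite invfM mulrA mulfVK//.
  by rewrite gt_eqF// (lt_le_trans ltr01).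
have e1 : e <= eta / 4.
  by apply: le_trans eB; rewrite ler_peMr// ltW.
have e2 : e <= rho ^+ 4 / 4 by rewrite ge_min lexx orbT.
have [kappa [delta' [w [[ke de wc] [wu uw ws]]]]] := happ e e0.
have Kx0 : K x0 by move=> j; rewrite subrr normr0 ltW.
have fK : {within K, continuous (fun x => w x - phi x)}.
  apply: continuous_in_subspaceT => x /set_mem /KP/r0P[_ [_ phix]].
  by apply: continuousB; [exact: wc|exact: phix].
have [x1 /set_mem Kx1 x1max] := compact_EVT_max (ex_intro _ x0 Kx0)
  (@compact_box x0 rho) fK.
have [[[eta1 psi1] [psiu1 Ox1]] [C2x1 phix1]] := r0P _ (KP _ Kx1).
have q0 : quartic x0 x0 = 0 by exact: quarticxx.
have m0 := x1max x0 (mem_set Kx0).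
have wu1 := wu x1.
move: psi1; rewrite ltr_norml => /andP[psi1l psi1r].
have Q1 : quartic x0 x1 <= 2 * e by move: m0; rewrite /phi q0; lra.
have Q0 : 0 <= quartic x0 x1 by exact: sqr_ge0.
have x1in j : `|x1 0 j - x0 0 j| < rho.
  rewrite -(@ltr_pXn2r _ 4)// ?nnegrE ?(ltW rho0)//.
  apply: (@le_lt_trans _ _ (2 * e)); last by move: (exprn_gt0 4 rho0) e2; lra.
  apply: le_trans Q1; have := coord_le_quartic x0 x1 j.
  by rewrite -normrX ger0_norm// (exprM _ 2 2) sqr_ge0.
have x1n : \forall x \near x1, K x.
  pose m := \big[Num.min/rho]_j (rho - `|x1 0 j - x0 0 j|).
  have mpos : 0 < m.
    by apply: lt_bigmin => // j _; rewrite subr_gt0.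
  apply/nbhs_rVP; exists m => // y yx1 j.
  have : m <= rho - `|x1 0 j - x0 0 j| by exact: bigmin_le_cond.
  have := ler_distD (x1 0 j) (y 0 j) (x0 0 j).
  have := yx1 j; lra.
have w1u : `|w x1 - u x0| < eta.
  rewrite ltr_norml; move: m0; rewrite /phi q0 => m0.
  by apply/andP; split; lra.
have w1B : `|w x1| `^ (3 - gamma) <= B - 1.
  have g3 : 0 <= 3 - gamma by rewrite subr_ge0 (le_trans gamma_le2)// ler_nat.
  rewrite /B addrK; apply: (ge0_ler_powR g3); rewrite ?nnegrE//.
    by rewrite addr_ge0// ltW.
  rewrite -[w x1](subrK (u x0)) addrC (le_trans (ler_normD _ _))//.
  by rewrite lerD2l ltW.
have : 0 <= Fmax (grad phi x1) (hess phi x1) +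
    G q (fun x => c x + kappa) delta' x1 (w x1) (grad phi x1).
  apply: ws => //; apply: filterS x1n => x Kx.
  by have := x1max x (mem_set Kx); lra.
have := eta1 _ w1u; rewrite /Gop.
have kB : kappa * `|w x1| `^ (3 - gamma) <= e * (B - 1).
  apply: le_trans (ler_norm _) _; rewrite normrM [X in _ * X]ger0_norm ?powR_ge0//.
  by apply: ler_pM => //; exact: powR_ge0.
have dB : delta' - delta <= e by exact: le_trans (ler_norm _) de.
move: kB eB; rewrite mulrBr mulr1 [(c x1 + kappa) * _]mulrDl; lra.
Qed.

Lemma super_at_stable q c delta (O : set V) u x0 :
  open O -> O x0 -> {for x0, continuous q} -> {for x0, continuous c} ->
  (forall e, 0 < e -> exists (kappa delta' : R) w,
    [/\ `|kappa| <= e, `|delta' - delta| <= e & continuous w] /\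
    [/\ forall x, u x - e <= w x, w x0 <= u x0 + e &
        forall x, O x -> super_at gamma q (fun x => c x + kappa) delta' w x]) ->
  super_at gamma q c delta u x0.
Proof.
move=> oO Ox0 qc cc happ; apply/super_atP.
apply: (@sub_at_stable _ _ _ O) => //; first exact: continuousN.
move=> e /happ[kappa [delta' [w [[ke de wc] [wu uw ws]]]]].
exists (- kappa), (- delta'), (fun x => - w x); split.
  by split; [rewrite normrN|rewrite -opprD normrN|move=> x; exact: (continuousN (wc x))].
split=> [x||x Ox].
- by have := wu x; lra.
- lra.
- have /super_atP := ws x Ox; congr sub_at; apply/funext => y; exact: opprD.
Qed.

End Stability.

(** * Exponential cones *)

Section ExponentialCone.
Context {R : realType} {d : nat} (gamma : R).
Hypothesis (gamma_le2 : gamma <= 2).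
Local Notation V := 'rV[R]_d.+1.
Local Notation Fmax := (Fop gamma max_quad).
Local Notation Fmin := (Fop gamma min_quad).
Local Notation G := (Gop gamma).
Implicit Types (x z : V) (q : V -> V) (c : V -> R).

Definition expdist (k : R) z x : R := expR (- k * enorm (x - z)).

Lemma expdist_gt0 k z x : 0 < expdist k z x. Proof. exact: expR_gt0. Qed.

Lemma expdistxx k z : expdist k z z = 1.
Proof. by rewrite /expdist subrr enorm0 mulr0 expR0. Qed.

Lemma expdist_le1 k z x : 0 <= k -> expdist k z x <= 1.
Proof. by move=> k0; rewrite -expR0 ler_expR mulNr oppr_le0 mulr_ge0 ?enorm_ge0. Qed.

Lemma expdist_lt (k r : R) z x : 0 < k ->
  (expR (- k * r) < expdist k z x) = (enorm (x - z) < r).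
Proof. by move=> k0; rewrite ltr_expR !mulNr ltrN2 ltr_pM2l. Qed.

(** [h1] and [h2] are the first two derivatives of t -> exp(-k sqrt t). The square root is smooth
    for t > 0 only, so the vertex is excluded. *)
Lemma C2_with_expdist k z x0 : x0 != z ->
  let h1 t := - k / 2 * (expR (- k * Num.sqrt t) * (Num.sqrt t)^-1) in
  let h2 t := expR (- k * Num.sqrt t) *
    (k ^+ 2 / 4 * (Num.sqrt t)^-1 ^+ 2 + k / 4 * (Num.sqrt t)^-1 ^+ 3) in
  C2_with (expdist k z)
    (fun i x => 2 * h1 (sqdist z x) * (x - z) 0 i)
    (fun i j x => 4 * h2 (sqdist z x) * (x - z) 0 i * (x - z) 0 j +
                  2 * h1 (sqdist z x) * (i == j)%:R) x0.
Proof.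
move=> x0z h1 h2.
have tpos : \forall t \near sqdist z x0, 0 < t.
  by apply: lt_nbhsr; exact: sqdist_gt0.
have hd (t : R) : 0 < t ->
    is_derive t (1 : R) (fun t => expR (- k * Num.sqrt t)) (h1 t).
  move=> t0; have s0 : Num.sqrt t != 0 by rewrite gt_eqF// sqrtr_gt0.
  have d1 := is_derive1_sqrt t0.
  have d2 : is_derive t (1 : R) (fun t => - k * Num.sqrt t) (- k * (2 * Num.sqrt t)^-1).
    by have -> : (fun t => - k * Num.sqrt t) = (- k) \*: Num.sqrt; first exact: funext;
      exact: is_deriveZ.
  have d3 := is_derive_expR (- k * Num.sqrt t).
  have := @is_derive1_comp R expR (fun t => - k * Num.sqrt t) t _ _ d3 d2.
  congr is_derive; rewrite /h1; field => //.
apply: (@C2_with_radial _ _ (fun t : R => expR (- k * Num.sqrt t)) h1 h2).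
apply: filterS tpos => t t0.
have s0 : Num.sqrt t != 0 by rewrite gt_eqF// sqrtr_gt0.
have d1 := is_derive1_sqrt t0.
have d0 := hd t t0.
split => //.
- have d3 : is_derive t (1 : R) (fun t => (Num.sqrt t)^-1)
      (- (Num.sqrt t) ^- 2 *: (2 * Num.sqrt t)^-1) by exact: is_deriveV.
  have -> : h1 = (- k / 2) \*: ((fun t => expR (- k * Num.sqrt t)) *
      (fun t => (Num.sqrt t)^-1)) by apply/funext.
  have := is_deriveZ (- k / 2) (is_deriveM d0 d3); congr is_derive.
  by rewrite /h1 /h2 /GRing.scale /=; field.
have sc := @sqrt_continuous R t.
have vc : {for t, continuous (fun t => (Num.sqrt t)^-1)} by exact: (cvgV s0 sc).
apply: (@continuousM _ _ (fun t => expR (- k * Num.sqrt t))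
  (fun t => k ^+ 2 / 4 * (Num.sqrt t)^-1 ^+ 2 + k / 4 * (Num.sqrt t)^-1 ^+ 3)).
  apply: (@continuous_comp _ _ _ (fun t => - k * Num.sqrt t) expR).
    by apply: (@continuousM _ _ (fun=> - k) Num.sqrt); [exact: cst_continuous|].
  exact: continuous_expR.
have vX m : {for t, continuous (fun t => (Num.sqrt t)^-1 ^+ m)}.
  by apply: (@continuous_comp _ _ _ (fun t => (Num.sqrt t)^-1) (fun y => y ^+ m));
    [exact: vc|exact: exprn_continuous].
apply: (@continuousD _ _ _ (fun t => k ^+ 2 / 4 * (Num.sqrt t)^-1 ^+ 2)
  (fun t => k / 4 * (Num.sqrt t)^-1 ^+ 3));
  apply: (@continuousM _ _ (fun=> _)); by [exact: cst_continuous|exact: vX].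
Qed.

(** The operator sees the second derivative in the gradient direction only. For a radial exponential
    that derivative is k times the slope g, so the value is g^(2 - gamma) k g. The gradient does not
    vanish, hence the result is the same for every [crit]. *)
Lemma expdist_jet k z x0 (m a : R) : 0 < k -> 0 < m -> x0 != z ->
  let w x := m * expdist k z x + a in
  let g := m * k * expdist k z x0 in
  [/\ C2_near w x0, enorm (grad w x0) = g &
      forall crit, Fop gamma crit (grad w x0) (hess w x0) = k * g `^ (3 - gamma)].
Proof.
move=> k0 m0 x0z w g.
have [w1 w2 w3] := C2_withP (C2_with_expdist k x0z).
have [c1 c2 c3] := C2_affine m a w1.
set rho := enorm (x0 - z).
have rho0 : 0 < rho by rewrite enorm_gt0 subr_eq0.
have sE : Num.sqrt (sqdist z x0) = rho by [].
have s2 : sqdist z x0 = rho ^+ 2 by rewrite sqr_enorm.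
set e := expdist k z x0.
have eE : expR (- k * rho) = e by [].
have e0 : 0 < e by exact: expdist_gt0.
have gradwE : grad w x0 = (- (m * k * e * rho^-1)) *: (x0 - z).
  rewrite [LHS]c2 w2; apply/rowP => i; rewrite !mxE sE eE; field.
  by rewrite gt_eqF.
have g0 : 0 < g by rewrite !mulr_gt0.
have normE : enorm (grad w x0) = g.
  rewrite gradwE enormZ normrN gtr0_norm ?mulr_gt0 ?invr_gt0// -/rho.
  by rewrite divfK// gt_eqF.
split=> // crit; rewrite /Fop -enorm_gt0 normE g0.
have -> : quad (hess w x0) (grad w x0) = k * g * g ^+ 2.
  rewrite gradwE quadZr [hess _ _]c3 quadZl quadE w3.
  set h1 := - k / 2 * _; set h2 := expR _ * _.
  have -> : \sum_i (x0 - z) 0 i * (\sum_j (x0 - z) 0 j *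
     (\matrix_(i0, j0) (4 * h2 * (x0 - z) 0 i0 * (x0 - z) 0 j0 +
                2 * h1 * (i0 == j0)%:R)) i j) =
     4 * h2 * (rho ^+ 2) ^+ 2 + 2 * h1 * rho ^+ 2.
    rewrite -s2 /sqdist /dotv.
    set S := \sum_(i < d.+1) _ * _.
    (* The radial vector [x0 - z] is an eigenvector of the Hessian of a radial function. *)
    have inE i : \sum_j (x0 - z) 0 j * (\matrix_(i0, j0) (4 * h2 * (x0 - z) 0 i0 *
        (x0 - z) 0 j0 + 2 * h1 * (i0 == j0)%:R)) i j =
        (4 * h2 * S + 2 * h1) * (x0 - z) 0 i.
      rewrite (eq_bigr (fun j => 4 * h2 * (x0 - z) 0 i * ((x0 - z) 0 j * (x0 - z) 0 j) +
          2 * h1 * ((x0 - z) 0 j * (i == j)%:R))); last first.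
        by move=> j _; rewrite mxE; ring.
      rewrite big_split /= -!mulr_sumr -/S.
      rewrite [X in _ + _ * X](bigD1 i)//= eqxx mulr1 big1 ?addr0; first by ring.
      by move=> j ji; rewrite eq_sym (negbTE ji) mulr0.
    under eq_bigr do rewrite inE mulrCA.
    by rewrite -mulr_sumr -/S; ring.
  rewrite /h1 /h2 sE eE /g -/e; field.
  by rewrite gt_eqF.
have -> : 3 - gamma = - gamma + 2 + 1 by ring.
rewrite (@powRD _ _ (- gamma + 2)); last by rewrite (gt_eqF g0) implybT.
rewrite (@powRD _ _ (- gamma)); last by rewrite (gt_eqF g0) implybT.
by rewrite powRr1 ?(ltW g0)// (@powR_mulrn _ g 2) ?(ltW g0)//; ring.
Qed.

End ExponentialCone.

(** * Comparison with cones: Lipschitz bound and Harnack inequality *)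

Section Comparison.
Context {R : realType} {d : nat} (gamma : R) (O : set 'rV[R]_d.+1).
Hypotheses (gamma_le2 : gamma <= 2) (oO : open O) (cO : compact (closure O)).
Local Notation V := 'rV[R]_d.+1.
Local Notation G := (Gop gamma).
Implicit Types (x z : V) (q : V -> V) (c : V -> R) (u : V -> R).

(** The drift has the same degree 3 - gamma in the gradient as the cone term k g^(3 - gamma), so it
    is dominated as soon as k exceeds Q. *)
Lemma drift_le q x p (Q : R) : norm1 (q x) <= Q ->
  `|dotv (q x) p * enorm p `^ (2 - gamma)| <= Q * enorm p `^ (3 - gamma).
Proof.
move=> qQ; rewrite normrM [X in _ * X]ger0_norm ?powR_ge0//.
have -> : enorm p `^ (3 - gamma) = enorm p * enorm p `^ (2 - gamma).
  have [p0|p0] := eqVneq (enorm p) 0.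
    by rewrite p0 mul0r powR0// gt_eqF// subr_gt0 (le_lt_trans gamma_le2)// ltr_nat.
  rewrite -[X in X * _]powRr1 ?enorm_ge0// -powRD ?p0 ?implybT//.
  by congr (_ `^ _); ring.
rewrite mulrA ler_wpM2r ?powR_ge0//; apply: (le_trans (norm_dotv_le _ _)).
by rewrite ler_wpM2r ?enorm_ge0.
Qed.

Lemma expdist_continuous k z : continuous (expdist k z).
Proof.
move=> x; apply: (@continuous_comp _ _ _ (fun x => - k * enorm (x - z)) expR).
  apply: (@continuousM _ _ (fun=> - k) (fun x => enorm (x - z))).
    exact: cst_continuous.
  apply: (@continuous_comp _ _ _ (sqdist z) Num.sqrt).
    exact: continuous_sqdist.
  exact: sqrt_continuous.
exact: continuous_expR.
Qed.

(* Comparison with exponential cones with vertex at an arbitrary point: they are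
   strict supersolutions away from the vertex, so no boundary regularity is
   needed, and the estimate holds up to (and across) the boundary. *)
Lemma sub_expdist_bound q c (delta Q C M k L : R) u :
  continuous u -> (forall x, 0 <= u x <= M) -> (forall x, ~ O x -> u x = 0) ->
  (forall x, O x -> norm1 (q x) <= Q) ->
  (forall x, O x -> c x * `|u x| `^ (3 - gamma) + delta <= C) ->
  (forall x, O x -> sub_at gamma q c delta u x) ->
  0 <= Q -> 0 <= C -> Q + C + 1 <= k -> 0 < L ->
  M <= L * (1 - expR (- k)) -> 1 <= L * k * expR (- k) ->
  forall z y, u y <= u z + L * (1 - expdist k z y).
Proof.
move=> uc u0M uO qQ cC us Q0 C0 kQC L0 ML Lk z y.
have k0 : 0 < k by lra.
have kQ : 0 <= k - Q by lra.
rewrite leNgt; apply/negP => uy.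
pose w x := L * expdist k z x + (- (u z + L)).
pose f x := u x + w x.
have fy : 0 < f y by rewrite /f /w; move: uy; lra.
have E1 x := expdist_le1 z x (ltW k0).
(* [u] can exceed the nonnegative function [u z + L * (1 - expdist k z x)] only inside [O], wherever
   the vertex [z] lies. *)
have fO x : 0 < f x -> O x /\ L * (1 - expdist k z x) < M.
  move=> fx; have [_ uM] := andP (u0M x); have [uz0 _] := andP (u0M z).
  have wx : 0 <= L * (1 - expdist k z x) by rewrite mulr_ge0 ?(ltW L0)// subr_ge0.
  move: fx; rewrite /f /w => fx; split; last by lra.
  apply: contrapT => nOx; move: fx; rewrite (uO _ nOx); lra.
have fc : {within closure O, continuous f}.
  apply: continuous_subspaceT => x; apply: continuousD; first exact: uc.
  apply: (@continuousD _ _ _ (fun x => L * expdist k z x) (fun=> _)).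
    by apply: (@continuousM _ _ (fun=> L) (expdist k z));
      [exact: cst_continuous|exact: expdist_continuous].
  exact: cst_continuous.
have yO : closure O y by apply: subset_closure; case: (fO _ fy).
have [x1 _ x1max] := compact_EVT_max (ex_intro _ y yO) cO fc.
have fx1 : 0 < f x1 by apply: lt_le_trans fy _; apply: x1max; exact: mem_set.
have [Ox1 x1M] := fO _ fx1.
have x1z : x1 != z.
  apply: contraTneq fx1 => ->; rewrite /f /w expdistxx mulr1 -leNgt.
  by lra.
have [w1 w2 w3] := expdist_jet gamma (- (u z + L)) k0 L0 x1z.
have [v1 v2 v3] := C2_opp w1.
set g := L * k * expdist k z x1 in w2 w3.
have := us x1 Ox1 _ v1 _; rewrite v2 v3 FopN w3 => sx1.
have {}sx1 : 0 <= - (k * g `^ (3 - gamma)) +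
    G q c delta x1 (u x1) (- grad (fun x => L * expdist k z x + (- (u z + L))) x1).
  apply: sx1; have On : \forall x \near x1, O x by exact: open_nbhs_nbhs.
  apply: filterS On => x /(@subset_closure _ O)/mem_set/x1max.
  by rewrite /f /w; lra.
(* Since [M <= L * (1 - expR (- k))], the point [x1] is at distance less than 1 from [z], where the
   slope is at least [L * k * expR (- k)]. A slope of at least 1 makes (k - Q) g^(3 - gamma) exceed
   C. *)
have gg1 : 1 <= g.
  apply: (le_trans Lk); rewrite ler_wpM2l ?mulr_ge0 ?(ltW L0) ?(ltW k0)//.
  by have := lt_le_trans x1M ML; rewrite ltr_pM2l//; lra.
have g3 : 0 <= 3 - gamma by rewrite subr_ge0 (le_trans gamma_le2)// ler_nat.
have g1 : 1 <= g `^ (3 - gamma).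
  by have := ler_powR gg1 g3; rewrite powRr0.
have := drift_le (- grad (fun x => L * expdist k z x + (- (u z + L))) x1) (qQ x1 Ox1).
rewrite enormN w2 ler_norml => /andP[_ dr].
have := cC x1 Ox1; move: sx1; rewrite /Gop enormN w2 => sx1 cx1.
have := ler_wpM2l kQ g1; rewrite mulr1 mulrBl.
by move: sx1 cx1 dr kQC; lra.
Qed.

(** The cone equal to [u y] at the vertex and to 0 at distance [r] stays below [u]: at a negative
    minimum of the difference, the strict inequality of the cone contradicts that of [u]. All terms
    have degree 3 - gamma, so [k] does not depend on [u]. *)
Lemma super_harnack q c (Q C k r : R) u y :
  {within closure O, continuous u} -> (forall x, closure O x -> 0 <= u x) ->
  (forall x, O x -> norm1 (q x) <= Q) -> (forall x, O x -> - C <= c x) ->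
  (forall x, O x -> super_at gamma q c 0 u x) ->
  0 <= Q -> 0 <= C -> Q + C + 1 <= k -> 0 < r ->
  (forall x, enorm (x - y) < r -> O x) ->
  forall x, enorm (x - y) < r ->
    u y * (expdist k y x - expR (- k * r)) <= u x * (1 - expR (- k * r)).
Proof.
move=> uc u0 qQ cC us Q0 C0 kQC r0 ball x xy.
have k0 : 0 < k by lra.
have kQ : 0 < k - Q - C by lra.
have k1 : 1 <= k by lra.
have Oy : O y by apply: ball; rewrite subrr enorm0.
have er1 : expR (- k * r) < 1.
  by rewrite -expR0 ltr_expR mulNr oppr_lt0 mulr_gt0.
have := u0 y (subset_closure Oy); rewrite le_eqVlt => /predU1P[<-|uy0].
  by rewrite mul0r mulr_ge0 ?subr_ge0 ?(ltW er1)//; exact/u0/subset_closure/ball.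
rewrite leNgt; apply/negP => ux.
have e10 : 0 < 1 - expR (- k * r) by rewrite subr_gt0.
pose m := u y / (1 - expR (- k * r)).
have m0 : 0 < m by rewrite divr_gt0.
have mE : m * (1 - expR (- k * r)) = u y by rewrite divfK// gt_eqF.
pose w x := m * expdist k y x + (- (m * expR (- k * r))).
pose f x := u x - w x.
have fx : f x < 0.
  rewrite /f /w -mulrBr subr_lt0 /m mulrAC ltr_pdivlMr//.
have Oc : O x by exact: ball.
have fc : {within closure O, continuous f}.
  have wc : {within closure O, continuous w}.
    apply: continuous_subspaceT => t.
    apply: (@continuousD _ _ _ (fun x => m * expdist k y x) (fun=> _)).
      by apply: (@continuousM _ _ (fun=> m) (expdist k y));
        [exact: cst_continuous|exact: expdist_continuous].
    exact: cst_continuous.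
  by move=> t; apply: continuousB; [exact: uc|exact: wc].
have [x1 /set_mem x1O x1min] := compact_EVT_min (ex_intro _ x (subset_closure Oc)) cO fc.
have fx1 : f x1 < 0 by apply: le_lt_trans (x1min x _) fx; exact/mem_set/subset_closure.
have ux1 : u x1 < w x1 by move: fx1; rewrite /f subr_lt0.
(* Beyond distance [r] the cone is at most 0, hence below [u]; the minimum over all of [closure O]
   is thus attained inside the ball. *)
have x1r : enorm (x1 - y) < r.
  rewrite -(expdist_lt r y x1 k0) -(ltr_pM2l m0) -subr_gt0.
  exact: le_lt_trans (u0 x1 x1O) ux1.
have Ox1 : O x1 by exact: ball.
have x1y : x1 != y.
  apply: contraTneq fx1 => ->; rewrite /f /w expdistxx -mulrBr mE.
  by rewrite subrr ltxx.
have [w1 w2 w3] := expdist_jet gamma (- (m * expR (- k * r))) k0 m0 x1y.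
set g := m * k * expdist k y x1 in w2 w3.
have g0 : 0 < g.
  by apply: mulr_gt0; [exact: mulr_gt0|exact: expdist_gt0].
have := us x1 Ox1 _ w1 _; rewrite w3 => sx1.
have {}sx1 : k * g `^ (3 - gamma) +
    G q c 0 x1 (u x1) (grad (fun x => m * expdist k y x + (- (m * expR (- k * r)))) x1) <= 0.
  apply: sx1; have On : \forall x \near x1, O x by exact: open_nbhs_nbhs.
  apply: filterS On => t /(@subset_closure _ O)/mem_set/x1min.
  by rewrite /f /w; lra.
have g3 : 0 <= 3 - gamma by rewrite subr_ge0 (le_trans gamma_le2)// ler_nat.
(* Where [u] lies below the cone it also lies below the slope [g], because [1 <= k]; this bounds the
   zeroth-order term by C g^(3 - gamma). *)
have ug : `|u x1| `^ (3 - gamma) <= g `^ (3 - gamma).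
  apply: (ge0_ler_powR g3); rewrite ?nnegrE ?(ltW g0)//.
  rewrite ger0_norm ?u0//; apply: (le_trans (ltW ux1)).
  rewrite /w /g; apply: (@le_trans _ _ (m * expdist k y x1)).
    by rewrite gerDl oppr_le0 mulr_ge0 ?expR_ge0 ?(ltW m0).
  by rewrite ler_wpM2r ?(ltW (expdist_gt0 _ _ _))// ler_peMr// ltW.
have := drift_le (grad (fun x => m * expdist k y x + (- (m * expR (- k * r)))) x1) (qQ x1 Ox1).
rewrite w2 ler_norml => /andP[dr _].
have gp : 0 < g `^ (3 - gamma) by exact: powR_gt0.
have cu : - C * g `^ (3 - gamma) <= c x1 * `|u x1| `^ (3 - gamma).
  apply: (@le_trans _ _ (- C * `|u x1| `^ (3 - gamma))).
    by rewrite !mulNr lerN2 ler_wpM2l.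
  by rewrite ler_wpM2r ?powR_ge0// cC.
have := mulr_gt0 kQ gp; rewrite !mulrBl.
move: sx1; rewrite /Gop w2 addr0 => sx1.
by move: sx1 dr cu; lra.
Qed.

End Comparison.

(** * The set of admissible values *)

Section Eigenvalue.
Context {R : realType} {d : nat} (gamma : R) (O : set 'rV[R]_d.+1).
Local Notation V := 'rV[R]_d.+1.
Variables (q : V -> V) (c : V -> R).
Hypotheses (gamma_le2 : gamma <= 2) (oO : open O) (cO : compact (closure O)).
Hypotheses (O0 : O !=set0).
Hypotheses (q_cont : {within closure O, continuous q}).
Hypotheses (c_cont : {within closure O, continuous c}).
Local Notation G := (Gop gamma).
Local Notation lambdaO := (principal_eigenvalue gamma q c O).
Implicit Types (x z : V) (u : V -> R).

Lemma gamma_le3 : 0 <= 3 - gamma.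
Proof. by rewrite subr_ge0 (le_trans gamma_le2)// ler_nat. Qed.

Lemma within_closure_at (T : topologicalType) (f : V -> T) :
  {within closure O, continuous f} -> forall x, O x -> {for x, continuous f}.
Proof.
move=> fc x Ox; have := continuous_subspaceW (@subset_closure _ O) fc.
by rewrite continuous_open_subspace// => /(_ x (mem_set Ox)).
Qed.

Lemma closure_bound (f : V -> R) : {within closure O, continuous f} ->
  exists2 C, 0 <= C & forall x, closure O x -> `|f x| <= C.
Proof.
move=> fc; have [x0 Ox0] := O0.
have nfc : {within closure O, continuous (fun x => `|f x|)}.
  move=> x; apply: (@continuous_comp (subspace (closure O)) R R f Num.norm).
    exact: fc.
  exact: norm_continuous.
have [x1 _ x1max] := compact_EVT_max (ex_intro _ x0 (subset_closure Ox0)) cO nfc.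
by exists `|f x1| => // x /mem_set/x1max.
Qed.

Lemma drift_bound : exists2 Q, 0 <= Q & forall x, closure O x -> norm1 (q x) <= Q.
Proof.
have fc : {within closure O, continuous (fun x => norm1 (q x))}.
  move=> x; apply: cvg_big => [|i _]; first exact: add_continuous.
  apply: (@continuous_comp (subspace (closure O)) V R q (fun y : V => `|y 0 i|)).
    exact: q_cont.
  apply: (@continuous_comp V R R (fun y : V => y 0 i) Num.norm).
    exact: coord_continuous.
  exact: norm_continuous.
have [Q Q0 QP] := closure_bound fc; exists Q => // x /QP.
by apply: le_trans; exact: ler_norm.
Qed.

Lemma open_enorm_ball y : O y ->
  exists2 r : R, 0 < r & forall x, enorm (x - y) < r -> O x.
Proof.
move=> Oy; have /nbhs_rVP[r r0 rP] : nbhs y O by exact: open_nbhs_nbhs.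
exists r => // x xy; apply: rP => j.
by have := coord_le_enorm (x - y) j; rewrite !mxE => /le_lt_trans; exact.
Qed.

Lemma admissibleP lambda : admissible gamma q c O lambda ->
  exists (phi : V -> R) (m : R), [/\ {within closure O, continuous phi}, 0 < m,
    forall x, closure O x -> m <= phi x &
    forall x, O x -> super_at gamma q (fun x => c x + lambda) 0 phi x].
Proof.
move=> [phi [phic phiS phi0]]; exists phi, (inf (phi @` closure O)).
have hi : has_inf (phi @` closure O).
  (* A set without infimum has [inf] equal to 0 by default, which positivity excludes. *)
  by apply: contrapT => /inf_out H; move: phi0; rewrite H ltxx.
have mphi x : closure O x -> inf (phi @` closure O) <= phi x.
  by move=> xO; apply: ge_inf; [exact: hi.2|exists x].
split=> // x Ox; apply: (visc_super_at phiS Ox) => p.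
by apply: eigen_GE; rewrite (le_trans (ltW phi0))// mphi//; exact: subset_closure.
Qed.

Lemma super_admissible lambda (phi : V -> R) (m : R) :
  {within closure O, continuous phi} -> 0 < m ->
  (forall x, closure O x -> m <= phi x) ->
  (forall x, O x -> super_at gamma q (fun x => c x + lambda) 0 phi x) ->
  admissible gamma q c O lambda.
Proof.
move=> phic m0 mphi phiS; exists phi; split=> //.
  apply: super_at_visc phiS => //.
    by move=> x /set_mem Ox; exact: within_closure_at.
  move=> x p Ox; apply: eigen_GE.
  by rewrite (le_trans (ltW m0))// mphi//; exact: subset_closure.
apply: (lt_le_trans m0); apply: lb_le_inf.
  by have [x0 Ox0] := O0; exists (phi x0), x0 => //; exact: subset_closure.
by move=> _ [x xO <-]; exact: mphi.
Qed.

Lemma admissible_neq0 : [set lambda | admissible gamma q c O lambda] !=set0.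
Proof.
have [C C0 CP] := closure_bound c_cont.
exists (- C); apply: (@super_admissible _ (fun=> 1) 1) => //.
  by apply: continuous_subspaceT; exact: cst_continuous.
move=> x Ox; apply: super_at_cst.
rewrite normr1 powR1 mulr1 addr0 subr_le0.
by apply: le_trans (ler_norm _) _; apply: CP; exact: subset_closure.
Qed.

Lemma C2_with_sqdist z x0 : C2_with (sqdist z)
  (fun i x => 2 * 1 * (x - z) 0 i)
  (fun i j x => 4 * 0 * (x - z) 0 i * (x - z) 0 j + 2 * 1 * (i == j)%:R) x0.
Proof.
apply: (@C2_with_radial _ _ id (fun=> 1) (fun=> 0)).
near=> t; split; last exact: cst_continuous.
  exact: is_derive_id.
exact: is_derive_cst.
Unshelve. all: by end_near. Qed.

Lemma paraboloid_jet z x0 (K : R) :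
  let w x := - K * sqdist z x + 0 in
  [/\ C2_near w x0, grad w x0 = (- K * 2) *: (x0 - z) &
      forall xi, quad (hess w x0) xi = - (2 * K) * enorm xi ^+ 2].
Proof.
move=> w; have [w1 w2 w3] := C2_withP (C2_with_sqdist z x0).
have [c1 c2 c3] := C2_affine (- K) 0 w1.
split=> //; first by rewrite [LHS]c2 w2; apply/rowP => i; rewrite !mxE; ring.
move=> xi; rewrite [hess _ _]c3 w3 quadZl quadE sqr_enorm /dotv.
have -> : \sum_i xi 0 i * (\sum_j xi 0 j * (\matrix_(i0, j0)
    (4 * 0 * (x0 - z) 0 i0 * (x0 - z) 0 j0 + 2 * 1 * (i0 == j0)%:R)) i j) =
    2 * \sum_i xi 0 i * xi 0 i.
  rewrite mulr_sumr; apply: eq_bigr => i _.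
  rewrite (bigD1 i)//= mxE eqxx big1 ?addr0 => [|j ji]; first by rewrite /=; ring.
  by rewrite mxE eq_sym (negbTE ji) /=; ring.
by ring.
Qed.

(** If lambda is large then [c + lambda] is nonnegative, so Harnack applies with C = 0 and a
    constant [theta] independent of lambda. A paraboloid touching the admissible function from below
    near [y] then bounds lambda; its opening is proportional to [phi y], which cancels by
    homogeneity. *)
Lemma admissible_bounded : exists B, forall lambda, admissible gamma q c O lambda ->
  lambda <= B.
Proof.
have [C C0 CP] := closure_bound c_cont.
have [Q Q0 QP] := drift_bound.
have [y Oy] := O0.
have [r r0 rP] := open_enorm_ball Oy.
pose k := Q + 1.
have k0 : 0 < k by rewrite /k; lra.
have er1 : expR (- k * r) < 1.
  by rewrite -expR0 ltr_expR mulNr oppr_lt0 mulr_gt0.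
have er2 : expR (- k * r) < expR (- k * (r / 2)).
  by rewrite ltr_expR !mulNr ltrN2 ltr_pM2l// ltr_pdivrMr// ltr_pMr// ltr1n.
pose theta := (expR (- k * (r / 2)) - expR (- k * r)) / (1 - expR (- k * r)).
have theta0 : 0 < theta by rewrite divr_gt0// subr_gt0.
pose p3 := 3 - gamma.
(* At the contact point the gradient is at most 8 m / r and 2 K = (2 / r)(8 m / r). The operator and
   the drift are thus at least -(2 / r + Q)(8 m / r)^p3, against (c + lambda)(theta m)^p3. *)
pose B := (2 / r + Q) * (8 / r) `^ p3 / theta `^ p3.
have tp0 : 0 < theta `^ p3 by exact: powR_gt0.
have B0 : 0 <= B.
  by rewrite divr_ge0 ?powR_ge0// mulr_ge0 ?powR_ge0// addr_ge0// divr_ge0// ltW.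
exists (C + B) => lambda /admissibleP[phi [m0 [phic m00 m0phi phiS]]].
rewrite leNgt; apply/negP => lB.
have phi0 x : closure O x -> 0 <= phi x by move=> /m0phi; apply: le_trans; exact: ltW.
have yO : closure O y by exact: subset_closure.
set m := phi y; have m_gt0 : 0 < m by exact: lt_le_trans (m0phi y yO).
have clam x : O x -> B < c x + lambda.
  move=> Ox; have := CP x (subset_closure Ox); rewrite ler_norml => /andP[? _]; lra.
have harnack x : enorm (x - y) < r -> m * (expdist k y x - expR (- k * r)) <=
    phi x * (1 - expR (- k * r)).
  apply: (super_harnack gamma_le2 oO cO phic phi0 _ _ phiS Q0 (lexx 0)) => //.
  - by move=> z Oz; exact: QP (subset_closure Oz).
  - by move=> z Oz; rewrite oppr0 (le_trans B0)// ltW// clam.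
  - by rewrite addr0.
(* With this opening, K (r / 2)^2 = 2 m exceeds the value m at [y], which forces the minimum into
   the half ball. *)
pose K := 8 * m / r ^+ 2.
have K0 : 0 < K by rewrite divr_gt0 ?mulr_gt0// exprn_gt0.
pose w x := - K * sqdist y x + 0.
pose f x := phi x - w x.
have fc : {within closure O, continuous f}.
  have wc : {within closure O, continuous w}.
    apply: continuous_subspaceT => t.
    apply: (@continuousD _ _ _ (fun x => - K * sqdist y x) (fun=> _)).
      by apply: (@continuousM _ _ (fun=> - K) (sqdist y));
        [exact: cst_continuous|exact: continuous_sqdist].
    exact: cst_continuous.
  by move=> t; apply: continuousB; [exact: phic|exact: wc].
have [x1 /set_mem x1O x1min] := compact_EVT_min (ex_intro _ y yO) cO fc.
have fx1 : phi x1 + K * sqdist y x1 <= m.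
  have := x1min y (mem_set yO); rewrite /f /w sqdistxx mulr0 !addr0 subr0 -/m.
  by rewrite mulNr opprK.
have x1r : enorm (x1 - y) < r / 2.
  rewrite -(@ltr_pXn2r _ 2)// ?nnegrE ?enorm_ge0 ?divr_ge0 ?(ltW r0)//.
  rewrite sqr_enorm -/(sqdist y x1) -(ltr_pM2l K0).
  have -> : K * (r / 2) ^+ 2 = 2 * m by rewrite /K; field; rewrite gt_eqF.
  by have := lt_le_trans m00 (m0phi _ x1O); lra.
have x1r' : enorm (x1 - y) < r by apply: lt_trans x1r _; lra.
have Ox1 : O x1 by exact: rP.
have phix1 : theta * m <= phi x1.
  rewrite /theta mulrAC ler_pdivrMr ?subr_gt0//.
  apply: le_trans (harnack x1 x1r'); rewrite mulrC ler_wpM2l ?(ltW m_gt0)//.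
  by rewrite lerD2r ltW// expdist_lt.
have [w1 w2 w3] := paraboloid_jet y x1 K.
have := phiS x1 Ox1 _ w1 _; rewrite -/w => sx1.
have {}sx1 : Fop gamma min_quad (grad w x1) (hess w x1) +
    G q (fun x => c x + lambda) 0 x1 (phi x1) (grad w x1) <= 0.
  apply: sx1; have On : \forall x \near x1, O x by exact: open_nbhs_nbhs.
  by apply: filterS On => t /(@subset_closure _ O)/mem_set/x1min; rewrite /f /w; lra.
have Fge := @Fop_min_ge _ _ gamma gamma_le2 (grad w x1) (hess w x1) (2 * K).
have {}Fge : - (2 * K) * enorm (grad w x1) `^ (2 - gamma) <=
    Fop gamma min_quad (grad w x1) (hess w x1).
  by apply: Fge => xi; rewrite w3.
have gle : enorm (grad w x1) <= 8 * m / r.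
  have K20 : 0 < K * 2 by exact: mulr_gt0.
  rewrite w2 enormZ mulNr normrN (gtr0_norm K20).
  have -> : 8 * m / r = K * 2 * (r / 2) by rewrite /K; field; rewrite gt_eqF.
  by apply: ler_wpM2l; [exact: ltW|exact: ltW].
have mr0 : 0 < 8 * m / r by rewrite divr_gt0// mulr_gt0.
have := drift_le gamma_le2 (grad w x1) (QP x1 x1O); rewrite ler_norml => /andP[dr _].
have p30 : 0 <= p3 := gamma_le3.
have p20 : 0 <= 2 - gamma by rewrite subr_ge0.
have gp3 : enorm (grad w x1) `^ p3 <= (8 * m / r) `^ p3.
  by apply: (ge0_ler_powR p30); [exact: enorm_ge0|exact: (ltW mr0)|exact: gle].
have gp2 : enorm (grad w x1) `^ (2 - gamma) <= (8 * m / r) `^ (2 - gamma).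
  by apply: (ge0_ler_powR p20); [exact: enorm_ge0|exact: (ltW mr0)|exact: gle].
have php : theta `^ p3 * m `^ p3 <= `|phi x1| `^ p3.
  rewrite -powRM ?(ltW theta0) ?(ltW m_gt0)//.
  have tm0 : 0 <= theta * m by exact: (mulr_ge0 (ltW theta0) (ltW m_gt0)).
  apply: (ge0_ler_powR p30); [exact: tm0|exact: normr_ge0|].
  by rewrite (ger0_norm (phi0 x1 x1O)).
have mr3 : 2 * K * (8 * m / r) `^ (2 - gamma) = 2 / r * (8 * m / r) `^ p3.
  have -> : p3 = 1 + (2 - gamma) by rewrite /p3; ring.
  rewrite (@powRD _ _ 1); last by rewrite (gt_eqF mr0) implybT.
  by rewrite powRr1 ?(ltW mr0)// /K; field; rewrite gt_eqF.
have mrM : (8 * m / r) `^ p3 = (8 / r) `^ p3 * m `^ p3.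
  rewrite -powRM ?(ltW m_gt0) ?divr_ge0 ?(ltW r0)//.
  by congr (_ `^ _); ring.
have mp0 : 0 < m `^ p3 by exact: powR_gt0.
have s1 : (c x1 + lambda) * (theta `^ p3 * m `^ p3) <= (c x1 + lambda) * `|phi x1| `^ p3.
  by apply: ler_wpM2l php; rewrite (le_trans B0)// ltW// clam.
have s2 : B * (theta `^ p3 * m `^ p3) < (c x1 + lambda) * (theta `^ p3 * m `^ p3).
  by rewrite ltr_pM2r; [exact: clam|exact: mulr_gt0].
have s3 : B * (theta `^ p3 * m `^ p3) = (2 / r + Q) * (8 * m / r) `^ p3.
  by rewrite /B mrM; field; rewrite ?(gt_eqF tp0) ?(gt_eqF r0).
have s4 : 2 * K * enorm (grad w x1) `^ (2 - gamma) <= 2 / r * (8 * m / r) `^ p3.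
  by rewrite -mr3; apply: ler_wpM2l gp2; exact: (mulr_ge0 _ (ltW K0)).
have s5 : Q * enorm (grad w x1) `^ p3 <= Q * (8 * m / r) `^ p3 by rewrite ler_wpM2l.
move: sx1 Fge dr s1 s2 s3 s4 s5; rewrite /Gop -/p3 addr0 mulNr mulrDl; clear -R; lra.
Qed.

Lemma admissible_ub lambda : admissible gamma q c O lambda -> lambda <= lambdaO.
Proof.
move=> la; have [B BP] := admissible_bounded.
by apply: ub_le_sup => //; exists B.
Qed.

Lemma admissible_gt lambda : lambda < lambdaO ->
  exists2 lambda', admissible gamma q c O lambda' & lambda < lambda'.
Proof. by move=> ll; apply: sup_gt => //; exact: admissible_neq0. Qed.

End Eigenvalue.

(** * Perron's method *)

Section Perron.
Context {R : realType} {d : nat} (gamma : R) (O : set 'rV[R]_d.+1).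
Local Notation V := 'rV[R]_d.+1.
Hypotheses (gamma_le2 : gamma <= 2) (oO : open O) (cO : compact (closure O)).
Hypotheses (O0 : O !=set0).
Local Notation G := (Gop gamma).
Implicit Types (x z : V) (u : V -> R) (q : V -> V) (c : V -> R).

Lemma expdistC k z x : expdist k z x = expdist k x z.
Proof. by rewrite /expdist -opprB enormN. Qed.

(** Using the bound in both orders of [z] and [y] turns it into a modulus of continuity that depends
    on [L] and [k] alone. *)
Lemma expdist_bound_continuous u (L k : R) :
  (forall z y, u y <= u z + L * (1 - expdist k z y)) -> continuous u.
Proof.
move=> uL z.
have vc : L * (1 - expdist k z y) @[y --> z] --> L * (1 - expdist k z z).
  apply: (@continuousM _ _ (fun=> L) (fun y => 1 - expdist k z y)).
    exact: cst_continuous.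
  apply: (@continuousD _ _ _ (fun=> 1 : R) (fun y => - expdist k z y)).
    exact: cst_continuous.
  by apply: continuousN; exact: expdist_continuous.
apply: (iffRL (@cvgrPdist_lt _ _ _ (nbhs z) _ u (u z))) => e e0.
move: vc; rewrite expdistxx subrr mulr0 => /cvgrPdist_lt/(_ _ e0).
apply: filterS => y; rewrite sub0r normrN => H.
have H1 := le_lt_trans (ler_norm _) H.
have := uL z y; have := uL y z; rewrite (expdistC k y z) => h1 h2.
by rewrite ltr_norml; apply/andP; split; lra.
Qed.

(** [L] and [k] are fixed before the coefficients and the function, so the modulus is common to the
    whole Perron class and to all approximate eigenfunctions. *)
Lemma sub_equicontinuous (Q C M : R) : 0 <= Q -> 0 <= C -> 0 <= M ->
  exists L k : R, [/\ 0 < L, 0 < k & forall q c delta u,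
    continuous u -> (forall x, 0 <= u x <= M) -> (forall x, ~ O x -> u x = 0) ->
    (forall x, O x -> norm1 (q x) <= Q) ->
    (forall x, O x -> c x * `|u x| `^ (3 - gamma) + delta <= C) ->
    (forall x, O x -> sub_at gamma q c delta u x) ->
    forall z y, u y <= u z + L * (1 - expdist k z y)].
Proof.
move=> Q0 C0 M0; pose k := Q + C + 1.
have k0 : 0 < k by rewrite /k; lra.
have ek1 : 0 < 1 - expR (- k) by rewrite subr_gt0 -expR0 ltr_expR oppr_lt0.
(* [A] meets the height condition and [B] the slope condition of the cone estimate; their sum meets
   both. *)
pose A := M / (1 - expR (- k)); pose B := (k * expR (- k))^-1.
have A0 : 0 <= A by rewrite divr_ge0// ltW.
have B0 : 0 < B by rewrite invr_gt0 mulr_gt0// expR_gt0.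
exists (A + B), k; split=> //; first by rewrite ltr_wpDl.
move=> q c delta u uc u0 uO qQ cC us.
apply: (sub_expdist_bound gamma_le2 oO cO uc u0 uO qQ cC us) => //.
- by rewrite ltr_wpDl.
- rewrite mulrDl /A divfK ?gt_eqF// lerDl mulr_ge0// ltW//.
- rewrite mulrDl mulrDl /B -[X in _ + X]mulrA mulVf ?gt_eqF ?mulr_gt0 ?expR_gt0//.
  by rewrite lerDr; exact: (mulr_ge0 (mulr_ge0 A0 (ltW k0)) (expR_ge0 _)).
Qed.

Lemma expdist_bound_sup (S : set (V -> R)) (L k : R) :
  (exists u, S u) -> (forall x, has_ubound [set u x | u in S]) ->
  (forall u, S u -> forall z y, u y <= u z + L * (1 - expdist k z y)) ->
  let U x := sup [set u x | u in S] in
  forall z y, U y <= U z + L * (1 - expdist k z y).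
Proof.
move=> [u0 Su0] bS SL U z y; apply: ge_sup.
  by exists (u0 y), u0.
move=> _ [u Su <-]; apply: (le_trans (SL u Su z y)); rewrite lerD2r.
by apply: ub_le_sup => //; exists u.
Qed.

Section PerronSolution.
Variables (q : V -> V) (c : V -> R) (delta : R) (W : V -> R).
Hypotheses (q_cont : {within closure O, continuous q}).
Hypotheses (c_cont : {within closure O, continuous c}).
Hypotheses (W_cont : {within closure O, continuous W}).
Hypotheses (delta_ge0 : 0 <= delta) (W_ge0 : forall x, O x -> 0 <= W x).
Hypotheses (W_super : forall x, O x -> super_at gamma q c delta W x).

(** Members live on the whole space and vanish off [O]: the boundary condition is part of the class
    and passes to the supremum. *)
Definition perron_class := [set u : V -> R |
  [/\ continuous u, forall x, 0 <= u x & forall x, ~ O x -> u x = 0] /\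
  [/\ forall x, O x -> u x <= W x & forall x, O x -> sub_at gamma q c delta u x]].

Definition perron_sol x := sup [set u x | u in perron_class].

Local Notation U := perron_sol.
Local Notation S := perron_class.

Lemma perron_class0 : S (fun=> 0).
Proof.
split; split=> //; first by move=> x; exact: cst_continuous.
move=> x Ox; apply: sub_at_cst; rewrite normr0 powR0 ?mulr0 ?add0r//.
by rewrite gt_eqF// subr_gt0 (le_lt_trans gamma_le2)// ltr_nat.
Qed.

Lemma perron_bound : exists2 M, 0 <= M & forall u, S u -> forall x, 0 <= u x <= M.
Proof.
have [M M0 MP] := closure_bound cO O0 W_cont; exists M => //.
move=> u [[_ u0 uO] [uW _]] x; rewrite u0 /=.
have [Ox|nOx] := pselect (O x); last by rewrite uO.
apply: (le_trans (uW x Ox)); apply: (le_trans (ler_norm _)); apply: MP.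
exact: subset_closure.
Qed.

Lemma perron_ub x : has_ubound [set u x | u in S].
Proof.
have [M _ MP] := perron_bound; exists M => _ [u Su <-].
by have /andP[] := MP u Su x.
Qed.

Lemma perron_le u x : S u -> u x <= U x.
Proof. by move=> Su; apply: ub_le_sup; [exact: perron_ub|exists u]. Qed.

Lemma perron_ge0 x : 0 <= U x. Proof. exact: (perron_le x perron_class0). Qed.

Lemma perron_out x : ~ O x -> U x = 0.
Proof.
move=> nOx; apply/eqP; rewrite eq_le perron_ge0 andbT; apply: ge_sup.
  by exists 0, (fun=> 0) => //; exact: perron_class0.
by move=> _ [u [[_ _ uO] _] <-]; rewrite uO.
Qed.

Lemma perron_leW x : O x -> U x <= W x.
Proof.
move=> Ox; apply: ge_sup; first by exists 0, (fun=> 0) => //; exact: perron_class0.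
by move=> _ [u [_ [uW _]] <-]; exact: uW.
Qed.

Lemma perron_continuous : continuous U.
Proof.
have [M M0 MP] := perron_bound.
have [Q Q0 QP] := drift_bound cO O0 q_cont.
have [C C0 CP] := closure_bound cO O0 c_cont.
have C1 : 0 <= C * M `^ (3 - gamma) + delta.
  by rewrite addr_ge0// mulr_ge0// powR_ge0.
have [L [k [L0 k0 Lk]]] := sub_equicontinuous Q0 C1 M0.
apply: (@expdist_bound_continuous _ L k).
apply: expdist_bound_sup; first by exists (fun=> 0); exact: perron_class0.
  exact: perron_ub.
move=> u Su; have [[uc u0 uO] [uW us]] := Su.
apply: (Lk q c delta) => //; first exact: MP.
  by move=> x Ox; exact: QP (subset_closure Ox).
move=> x Ox; rewrite lerD2r.
have /andP[_ uM] := MP u Su x.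
apply: (@le_trans _ _ (C * `|u x| `^ (3 - gamma))).
  rewrite ler_wpM2r ?powR_ge0//; apply: le_trans (ler_norm _) _.
  exact: CP (subset_closure Ox).
rewrite ler_wpM2l//; apply: (ge0_ler_powR (gamma_le3 gamma_le2)).
- exact: normr_ge0.
- exact: M0.
- by rewrite ger0_norm.
Qed.

Lemma perron_sub x : O x -> sub_at gamma q c delta U x.
Proof.
move=> Ox; apply: (sub_at_stable gamma_le2 oO Ox).
- exact: (within_closure_at oO q_cont).
- exact: (within_closure_at oO c_cont).
(* Stability asks for closeness from below at the one point [x] and for an upper bound elsewhere; a
   member nearly attaining the supremum at [x] provides both. *)
move=> e e0; have [|w [] u Su <- Uw] := @sup_adherent _ [set u x | u in S] e e0.
  by split; [exists 0, (fun=> 0) => //; exact: perron_class0|exact: perron_ub].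
have [[uc _ _] [_ us]] := Su.
exists 0, delta, u; split; first by split; rewrite ?subrr ?normr0 ?ltW.
split.
- by move=> y; rewrite (le_trans (perron_le y Su))// lerDl ltW.
- exact: ltW.
- move=> y Oy; rewrite (_ : (fun x => _) = c); first exact: us.
  by apply/funext => z; rewrite addr0.
Qed.

(** Where [U] touches [W], the inequality is inherited from [W]. Elsewhere a test function violating
    it could be lifted and glued into [U], giving a member of the class larger than [U] at [x0]. *)
Lemma perron_super x0 : O x0 -> super_at gamma q c delta U x0.
Proof.
move=> Ox0 psi psiC psiU; rewrite leNgt; apply/negP => v0.
have On : \forall x \near x0, O x by exact: open_nbhs_nbhs.
have := perron_leW Ox0; rewrite le_eqVlt => /predU1P[UW|UW].
  have : super_at gamma q c delta U x0.
    apply: (super_at_le (W_super Ox0)); last by move=> p; rewrite UW.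
    by apply: filterS On => x Ox; rewrite UW lerD2r perron_leW.
  by move=> /(_ psi psiC psiU); rewrite leNgt v0.
have [C2p gp hp] := C2_add_quartic (U x0 - psi x0) (-1) psiC.
set phi := (fun x => psi x + -1 * quartic x0 x + (U x0 - psi x0)) in C2p gp hp.
have phi0 : phi x0 = U x0 by rewrite /phi quarticxx; lra.
rewrite -gp -hp in v0.
have [eta eta0 etaP] := strict_super_open gamma_le2 C2p
  (within_closure_at oO q_cont Ox0) (within_closure_at oO c_cont Ox0) v0.
(* The first bound keeps [phi x + kap] within eta of [U x0]; a third of the gap keeps the lifted
   function below [W], as three errors of size [e] add up. *)
pose e := Num.min (eta / 2) ((W x0 - U x0) / 3).
have e0 : 0 < e by rewrite lt_min !divr_gt0// subr_gt0.
have phi_c := C2_continuous C2p.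
have phi_n : \forall x \near x0, `|phi x0 - phi x| < e.
  by have := nbhs_singleton phi_c => /cvgrPdist_lt/(_ _ e0).
have W_n : \forall x \near x0, `|W x0 - W x| < e.
  by have := within_closure_at oO W_cont Ox0 => /cvgrPdist_lt/(_ _ e0).
have [r0 r00 r0P] := iffLR (nbhs_rVP _ _) (filterI (filterI (filterI etaP phi_n)
   (filterI psiU On)) (filterI (filterI (near_join C2p) phi_c) W_n)).
pose rho := r0 / 2.
have rho0 : 0 < rho by rewrite divr_gt0.
pose kap := Num.min e (rho ^+ 4 / 2).
have kap0 : 0 < kap by rewrite lt_min e0 divr_gt0// exprn_gt0.
have kape : kap <= e by rewrite ge_min lexx.
have kapr : kap < rho ^+ 4.
  apply: (@le_lt_trans _ _ (rho ^+ 4 / 2)); first by rewrite ge_min lexx orbT.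
  by rewrite ltr_pdivrMr// ltr_pMr ?ltr1n// exprn_gt0.
pose box x := [forall j, `|x 0 j - x0 0 j| <= rho].
pose uh x := if box x then Num.max (U x) (phi x + kap) else U x.
have Uuh x : U x <= uh x by rewrite /uh; case: ifP => // _; rewrite le_max lexx.
pose near0 x := forall j, `|x 0 j - x0 0 j| < r0.
have box_near x : box x -> near0 x.
  by move=> /forallP bx j; apply: le_lt_trans (bx j) _; rewrite /rho ltr_pdivrMr// ltr_pMr ?ltr1n.
(* Between the boxes of radii rho and r0 the quartic exceeds [kap], so the maximum is [U] there. The
   two formulas for [uh] thus agree on an overlap, and [uh] is locally given by one of them. *)
have uhE x : near0 x -> uh x = Num.max (U x) (phi x + kap).
  move=> nx; rewrite /uh; case: ifPn => //.
  rewrite negb_forall => /existsP[j]; rewrite -ltNge => rj.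
  have [[_ [psiUx _]] _] := r0P x nx.
  have : rho ^+ 4 <= quartic x0 x.
    apply: le_trans (coord_le_quartic x0 x j).
    rewrite (exprM _ 2 2) (exprM _ 2 2) -[X in _ <= X ^+ 2]real_normK ?num_real//.
    rewrite -!exprM; apply: lerXn2r; rewrite ?nnegrE ?(ltW rho0)//.
    exact: ltW.
  move=> qr; apply/esym/max_idPl; rewrite /phi.
  by move: psiUx kapr qr; lra.
have near0_nbhs x : near0 x -> \forall y \near x, near0 y.
  move=> nx; pose m := \big[Num.min/r0]_j (r0 - `|x 0 j - x0 0 j|).
  have mpos : 0 < m by apply: lt_bigmin => // j _; rewrite subr_gt0.
  apply/nbhs_rVP; exists m => // y yx j.
  have : m <= r0 - `|x 0 j - x0 0 j| by exact: bigmin_le_cond.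
  by have := ler_distD (x 0 j) (y 0 j) (x0 0 j); have := yx j; lra.
have nbox_nbhs x : ~ near0 x -> \forall y \near x, ~~ box y.
  move=> /existsNP[j /negP]; rewrite -leNgt => rj.
  apply/nbhs_rVP; exists rho => // y yx; rewrite negb_forall; apply/existsP; exists j.
  rewrite -ltNge; have := ler_distD (y 0 j) (x 0 j) (x0 0 j).
  by have := yx j; rewrite (distrC (y 0 j) (x 0 j)); move: rj; rewrite /rho; lra.
have uhS : S uh.
  split; split.
  - move=> x; have [nx|nx] := pselect (near0 x).
      have [_ [[_ phix] _]] := r0P x nx.
      apply: (@near_eq_continuous_at _ _ (fun y => Num.max (U y) (phi y + kap))).
        by apply: filterS (near0_nbhs x nx) => y ny; rewrite uhE.
      apply: (@continuous_max R V U (fun y => phi y + kap)).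
        exact: perron_continuous.
      by apply: (@continuousD _ _ _ phi (fun=> kap)) => //; exact: cst_continuous.
    apply: (@near_eq_continuous_at _ _ U); last exact: perron_continuous.
    by apply: filterS (nbox_nbhs x nx) => y /negbTE by_; rewrite /uh by_.
  - by move=> x; exact: le_trans (perron_ge0 x) (Uuh x).
  - move=> x nOx; rewrite /uh; case: ifP => [/box_near/r0P[[_ [_ Ox]] _]//|_].
    exact: perron_out.
  - move=> x Ox; rewrite /uh; case: ifP => [/box_near/r0P|_]; last exact: perron_leW.
    move=> [[[_ phix] _] [_ Wx]]; rewrite ge_max perron_leW//=.
    have eW : e <= (W x0 - U x0) / 3 by rewrite ge_min lexx orbT.
    move: phix Wx; rewrite phi0 !ltr_norml => /andP[? ?] /andP[? ?]; lra.
  - move=> x Ox; have [uhU|uhU] := eqVneq (uh x) (U x).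
      apply: (sub_at_le (perron_sub Ox)); last by rewrite uhU.
      by near=> y; rewrite uhU lerD2r.
    have nx : near0 x.
      by apply: box_near; move: uhU; rewrite /uh; case: ifP; rewrite ?eqxx.
    have uhx : uh x = phi x + kap.
      move: uhU; rewrite uhE//; case: (leP (U x) (phi x + kap)) => //.
      by rewrite eqxx.
    have [[[etax phix] _] [[C2x _] _]] := r0P x nx.
    have [k1 k2 k3] := C2_affine 1 kap (C2x : C2_near phi x).
    have pE : (fun x => 1 * phi x + kap) = (fun x => phi x + kap).
      by apply/funext => y; rewrite mul1r.
    rewrite pE !scale1r in k1 k2 k3.
    have sk : sub_at gamma q c delta (fun x => phi x + kap) x.
      (* The strict inequality at hand concerns [Fmin]; [Fmax] dominates it, so the lifted test
         function is a classical subsolution. *)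
      apply: classical_sub_at => //; rewrite k2 k3.
      have : `|phi x + kap - U x0| < eta.
        have ee : e <= eta / 2 by rewrite ge_min lexx.
        by move: phix; rewrite phi0 !ltr_norml => /andP[? ?]; apply/andP; split; lra.
      move=> /etax; have := Fop_min_le_max gamma (grad phi x) (hess phi x); lra.
    apply: (sub_at_le sk); last by rewrite uhx.
    apply: filterS (near0_nbhs x nx) => y ny; rewrite uhx lerD2r uhE//.
    by rewrite le_max lexx orbT.
have := perron_le x0 uhS.
rewrite leNgt => /negP; apply; rewrite uhE; last by move=> j; rewrite subrr normr0.
by rewrite lt_max phi0 ltrDl kap0 orbT.
Unshelve. all: by end_near. Qed.

End PerronSolution.
End Perron.

(** * Approximate eigenfunctions and passage to the limit *)

Section Approximation.
Context {R : realType} {d : nat} (gamma : R) (O : set 'rV[R]_d.+1).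
Local Notation V := 'rV[R]_d.+1.
Variables (q : V -> V) (c : V -> R).
Hypotheses (gamma_le2 : gamma <= 2) (oO : open O) (cO : compact (closure O)).
Hypotheses (O0 : O !=set0).
Hypotheses (q_cont : {within closure O, continuous q}).
Hypotheses (c_cont : {within closure O, continuous c}).
Local Notation G := (Gop gamma).
Local Notation lambdaO := (principal_eigenvalue gamma q c O).
Implicit Types (x z : V) (u : V -> R).

Lemma powR_unif_continuous (p M e : R) : 0 <= p -> 0 < e ->
  exists2 eta, 0 < eta & forall r, 0 <= r <= M -> (r + eta) `^ p - r `^ p <= e.
Proof.
move=> p0 e0.
have cK : compact `[0, M]%classic by exact: segment_compact.
have H : \forall eta \near (0 : R), `[0, M]%classic `<=`
    (fun r => `|r + eta| `^ p - `|r| `^ p <= e).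
  apply: (iffLR (compact_near_coveringP _) cK R (nbhs (0 : R)) (fun eta r =>
    `|r + eta| `^ p - `|r| `^ p <= e) _) => r _.
  have cv : `|z.1 + z.2| `^ p - `|z.1| `^ p @[z --> (r, 0 : R)] -->
      `|r + 0| `^ p - `|r| `^ p.
    apply: cvgB.
      apply: (@cvg_powR_norm _ _ _ _ (fun z : R * R => z.1 + z.2)) => //.
      by apply: cvgD; [exact: cvg_fst|exact: cvg_snd].
    by apply: (@cvg_powR_norm _ _ _ _ (fun z : R * R => z.1)) => //; exact: cvg_fst.
  move: cv; rewrite addr0 subrr => /cvgrPdist_le/(_ _ e0).
  apply: filterS => -[r' eta] /=; rewrite sub0r normrN.
  exact: le_trans (ler_norm _).
have [eta /= eta0 etaP] := iffLR (nbhs_ballP _ _) H.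
exists (eta / 2); first by rewrite divr_gt0.
move=> r /andP[r0 rM].
have := etaP (eta / 2) _ r _; rewrite /ball/= sub0r normrN gtr0_norm ?divr_gt0//.
rewrite ltr_pdivrMr// ltr_pMr// ltr1n in_itv/= r0 rM => /(_ isT isT).
by rewrite !ger0_norm// addr_ge0// divr_ge0// ltW.
Qed.

Lemma within_closureZ (phi : V -> R) (a : R) :
  {within closure O, continuous phi} ->
  {within closure O, continuous (fun x => a * phi x)}.
Proof.
move=> pc x; apply: (@continuousM _ (subspace (closure O)) (fun=> a) phi).
  exact: cst_continuous.
exact: pc.
Qed.

(* Below the eigenvalue the inhomogeneous problem is solvable; its solutions blow
   up at the eigenvalue, for otherwise a small positive constant added to one of
   them would be admissible above the eigenvalue. *)
Lemma normalized_approximation (e : R) : 0 < e ->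
  exists (kappa delta : R) (v : V -> R),
  [/\ `|kappa| <= e, 0 <= delta <= e & continuous v] /\
  [/\ forall x, 0 <= v x <= 1, forall x, ~ O x -> v x = 0, exists x, v x = 1,
      forall x, O x -> sub_at gamma q (fun x => c x + lambdaO + kappa) delta v x &
      forall x, O x -> super_at gamma q (fun x => c x + lambdaO + kappa) delta v x].
Proof.
move=> e0; pose p := 3 - gamma.
have p0 : 0 < p by rewrite subr_gt0 (le_lt_trans gamma_le2)// ltr_nat.
have powK (a : R) : 0 < a -> (a `^ p^-1) `^ p = a.
  by move=> a0; rewrite -powRrM mulVf ?gt_eqF// powRr1 ?ltW.
(* A maximum of at least [M0] is what makes the normalized source, maximum^(-p), at most [e]. *)
pose M0 := e^-1 `^ p^-1.
have M0p : M0 `^ p = e^-1 by rewrite powK ?invr_gt0.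
have M00 : 0 < M0 by rewrite powR_gt0// invr_gt0.
have [C C0 CP] := closure_bound cO O0 c_cont.
pose B := C + `|lambdaO| + 1.
have B0 : 0 < B by rewrite ltr_wpDl// addr_ge0.
have iB0 : 0 < (2 * B)^-1 by rewrite invr_gt0 mulr_gt0.
have [eta eta0 etaP] := @powR_unif_continuous p M0 (2 * B)^-1 (ltW p0) iB0.
(* The source 1 is split in halves: [eta] was chosen so that adding it costs at most 1/2, and mu <=
   e/4 makes raising lambda from [lambdaO - mu] to [lambdaO + mu] cost at most 2 mu / e <= 1/2 while
   [u] stays below [M0]. *)
pose mu := Num.min 1 (e / 4).
have mu0 : 0 < mu by rewrite lt_min ltr01 divr_gt0.
have mu1 : mu <= 1 by rewrite ge_min lexx.
have mue : mu <= e / 4 by rewrite ge_min lexx orbT.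
have ll : lambdaO - mu < lambdaO by rewrite ltrBlDr ltrDl.
have [l' l'adm l'gt] := admissible_gt oO cO O0 c_cont ll.
have [phi [m [phic m0 mphi phiS]]] := admissibleP l'adm.
have dl0 : 0 < (l' - (lambdaO - mu))^-1 by rewrite invr_gt0 subr_gt0.
(* This factor makes (l' - (lambdaO - mu)) (k phi)^p at least 1, so the slack between the two values
   of lambda supplies the source 1. *)
pose k := (l' - (lambdaO - mu))^-1 `^ p^-1 / m.
have k0 : 0 < k by rewrite divr_gt0// powR_gt0.
pose cl x := c x + lambdaO + - mu.
have WS x : O x -> super_at gamma q cl 1 (fun x => k * phi x) x.
  move=> Ox; have := super_atZ gamma_le2 k0 (phiS x Ox); rewrite mulr0 => WS.
  apply: (super_at_le WS); first exact: filterE.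
  move=> pp; rewrite /Gop addr0 -addrA lerD2l /cl -/p.
  have phix := mphi x (subset_closure Ox).
  have : (l' - (lambdaO - mu))^-1 <= `|k * phi x| `^ p.
    rewrite -[leLHS]powK//; apply: (ge0_ler_powR (ltW p0)).
    - exact: powR_ge0.
    - exact: normr_ge0.
    rewrite ger0_norm; last by rewrite mulr_ge0// ?(ltW k0)// (le_trans (ltW m0)).
    by rewrite /k mulrAC ler_pdivlMr// ler_wpM2l// powR_ge0.
  move=> /(ler_wpM2l (ltW (_ : 0 < l' - (lambdaO - mu)))).
  rewrite subr_gt0 => /(_ l'gt); rewrite divff; last by rewrite gt_eqF// subr_gt0.
  by rewrite !mulrDl !mulNr; lra.
have Wc := @within_closureZ phi k phic.
have W0 x : O x -> 0 <= k * phi x.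
  by move=> Ox; rewrite mulr_ge0 ?(ltW k0)// (le_trans (ltW m0))// mphi//; exact: subset_closure.
have clc : {within closure O, continuous cl}.
  move=> x; apply: (@continuousD _ _ (subspace (closure O)) (fun x => c x + lambdaO) (fun=> - mu)).
    apply: (@continuousD _ _ (subspace (closure O)) c (fun=> lambdaO)); first exact: c_cont.
    exact: cst_continuous.
  exact: cst_continuous.
pose u := perron_sol gamma O q cl 1 (fun x => k * phi x).
have uc : continuous u by exact: perron_continuous.
have u0 x : 0 <= u x by exact: perron_ge0.
have uO x : ~ O x -> u x = 0 by exact: perron_out.
have usub x : O x -> sub_at gamma q cl 1 u x by exact: perron_sub.
have usup x : O x -> super_at gamma q cl 1 u x by exact: perron_super.
have [y Oy] := O0.
have [x1 x1O x1max] : exists2 x1, closure O x1 & forall x, u x <= u x1.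
  have := compact_EVT_max (ex_intro _ y (subset_closure Oy)) cO (continuous_subspaceT uc).
  move=> [x1 /set_mem x1O x1max]; exists x1 => // x.
  have [Ox|nOx] := pselect (O x); first exact: x1max (mem_set (subset_closure Ox)).
  by rewrite uO.
have M0u : M0 <= u x1.
  rewrite leNgt; apply/negP => uM.
  suff : admissible gamma q c O (lambdaO + mu).
    by move=> /(admissible_ub gamma_le2 oO cO O0 q_cont c_cont); lra.
  apply: (@super_admissible _ _ _ _ _ _ oO O0 _ (fun x => u x + eta) eta) => //.
  - apply: continuous_subspaceT => x.
    by apply: (@continuousD _ _ _ u (fun=> eta)); [exact: uc|exact: cst_continuous].
  - by move=> x _; rewrite lerDr.
  move=> x Ox; apply: (super_at_le (usup x Ox)); first by near=> t; lra.
  move=> pp; rewrite /Gop addr0 -[leRHS]addrA lerD2l -/p.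
  rewrite (ger0_norm (addr_ge0 (u0 x) (ltW eta0))) (ger0_norm (u0 x)).
  have uxM : 0 <= u x <= M0 by rewrite u0 (le_trans (x1max x))// ltW.
  have r1 := etaP (u x) uxM.
  have r2 : (u x) `^ p <= e^-1.
    rewrite -M0p; apply: (ge0_ler_powR (ltW p0)); [exact: u0|exact: (ltW M00)|].
    by case/andP: uxM.
  have r3 : 0 <= (u x + eta) `^ p - u x `^ p.
    rewrite subr_ge0; apply: (ge0_ler_powR (ltW p0)); first exact: u0.
      exact: (addr_ge0 (u0 x) (ltW eta0)).
    by rewrite lerDl ltW.
  have r4 : c x + (lambdaO + mu) <= B.
    have := le_trans (ler_norm _) (CP x (subset_closure Ox)).
    by have := ler_norm lambdaO; rewrite /B; lra.
  have r5 : (c x + (lambdaO + mu)) * ((u x + eta) `^ p - u x `^ p) <= 2^-1.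
    apply: (le_trans (ler_wpM2r r3 r4)); apply: (le_trans (ler_wpM2l (ltW B0) r1)).
    by rewrite invfM mulrCA divff ?gt_eqF// mulr1.
  have r6 : 2 * mu * u x `^ p <= 2^-1.
    have : 2 * mu * u x `^ p <= 2 * (e / 4) * e^-1.
      apply: ler_pM => //; [by rewrite mulr_ge0// ltW|exact: powR_ge0|].
      by rewrite ler_wpM2l.
    move=> /le_trans; apply; rewrite le_eqVlt; apply/orP; left; apply/eqP.
    by field; rewrite gt_eqF.
  move: r5 r6; rewrite /cl; set a := (u x + eta) `^ p; set b := u x `^ p.
  move=> r5 r6.
  have -> : (c x + (lambdaO + mu)) * a = (c x + (lambdaO + mu)) * (a - b) +
    2 * mu * b + (c x + lambdaO + - mu) * b by ring.
  lra.
have u10 : 0 < u x1 by exact: lt_le_trans M0u.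
have iu0 : 0 < (u x1)^-1 by rewrite invr_gt0.
exists (- mu), ((u x1)^-1 `^ p * 1), (fun x => (u x1)^-1 * u x).
split; split.
- by rewrite normrN gtr0_norm// (le_trans mue)// ler_pdivrMr// ler_peMr ?(ltW e0)// ler1n.
- rewrite mulr1 powR_ge0 /=.
  have -> : e = M0^-1 `^ p.
    apply: (mulIf (lt0r_neq0 (powR_gt0 p M00))).
    by rewrite -powRM ?invr_ge0 ?(ltW M00)// mulVf ?gt_eqF// powR1 M0p mulfV ?gt_eqF.
  apply: (ge0_ler_powR (ltW p0)); [exact: (ltW iu0)| |by rewrite lef_pV2].
  by rewrite nnegrE invr_ge0 ltW.
- by move=> x; apply: (@continuousM _ _ (fun=> _) u); [exact: cst_continuous|exact: uc].
- move=> x; rewrite mulr_ge0 ?(ltW iu0)//=.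
  by rewrite mulrC ler_pdivrMr// mul1r.
- by move=> x /uO ->; rewrite mulr0.
- by exists x1; rewrite mulVf// gt_eqF.
- by move=> x /usub; exact: sub_atZ.
- by move=> x /usup; exact: super_atZ.
Unshelve. all: by end_near. Qed.

End Approximation.

(** * Extraction of uniform limits *)

Section Compactness.
Context {R : realType} {d : nat} (O : set 'rV[R]_d.+1).
Local Notation V := 'rV[R]_d.+1.
Hypothesis (cO : compact (closure O)).

(* Arzela-Ascoli: a pointwise cluster point of an equicontinuous sequence is a
   uniform one. *)
Lemma equicontinuous_cluster (v : nat -> V -> R) (L k : R) :
  (forall n x, 0 <= v n x <= 1) -> (forall n x, ~ O x -> v n x = 0) ->
  (forall n z y, v n y <= v n z + L * (1 - expdist k z y)) ->
  exists f : V -> R, forall e (N : nat), 0 < e ->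
    exists2 n, (N <= n)%N & forall x, `|v n x - f x| <= e.
Proof.
move=> v01 vO vL.
have cK := @tychonoff V (fun=> R) (fun=> `[0, 1]%classic)
  (fun=> @segment_compact _ _ _).
pose F : set_system (prod_topology (fun _ : V => R)) := v @ \oo.
have FF : ProperFilter F by exact: fmap_proper_filter.
have FK : F [set f | forall x, `[0, 1]%classic (f x)].
  by apply: (@filterE _ \oo) => n x /=; rewrite in_itv/= v01.
have [f [_]] := cK F FF FK.
(* The finer filter [H] plays the role of a subsequence: it converges pointwise to [f], and whatever
   holds for all [v n], or for all large n, holds near [H]. *)
rewrite cluster_cvgE => -[H HF [Hf FH]].
have Hpt x e : 0 < e -> \forall w \near H, `|f x - w x| < e.
  move=> e0.
  have : (w x @[w --> H]) --> f x.
    apply: cvg_trans (@proj_continuous V (fun=> R) x f).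
    exact: cvg_app.
  by move=> /cvgrPdist_lt/(_ e e0).
have HL : \forall w \near H, forall z y, w y <= w z + L * (1 - expdist k z y).
  by apply: FH; apply: (@filterE _ \oo) => n; exact: vL.
have HO : \forall w \near H, forall x, ~ O x -> w x = 0.
  by apply: FH; apply: (@filterE _ \oo) => n; exact: vO.
have fL z y : f y <= f z + L * (1 - expdist k z y).
  apply/ler_addgt0Pl => e e0; have e2 : 0 < e / 2 by rewrite divr_gt0.
  have [w [[wy wz] wL]] := filter_ex (filterI (filterI (Hpt y _ e2) (Hpt z _ e2)) HL).
  move: wy wz; rewrite !ltr_norml => /andP[? ?] /andP[? ?].
  by have := wL z y; lra.
have fO x : ~ O x -> f x = 0.
  move=> nOx; apply/eqP; rewrite -normr_eq0 eq_le normr_ge0 andbT.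
  apply/ler_addgt0Pl => e e0.
  have [w [wx wO]] := filter_ex (filterI (Hpt x _ e0) HO).
  by move: wx; rewrite wO// subr0 addr0 => /ltW.
exists f => e N e0; have e3 : 0 < e / 3 by rewrite divr_gt0.
have Hunif : \forall w \near H, closure O `<=` (fun x => `|w x - f x| <= e).
  apply: (iffLR (compact_near_coveringP _) cO _ H (fun w x => `|w x - f x| <= e) _).
  move=> x _.
  have xL : \forall y \near x, L * (1 - expdist k x y) < e / 3.
    have : L * (1 - expdist k x y) @[y --> x] --> L * (1 - expdist k x x).
      apply: (@continuousM _ _ (fun=> L) (fun y => 1 - expdist k x y)).
        exact: cst_continuous.
      apply: (@continuousD _ _ _ (fun=> 1 : R) (fun y => - expdist k x y)).
        exact: cst_continuous.
      by apply: continuousN; exact: expdist_continuous.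
    rewrite expdistxx subrr mulr0 => /cvgrPdist_lt/(_ _ e3).
    apply: filterS => y; rewrite sub0r normrN; exact: le_lt_trans (ler_norm _).
  pose A := [set y : V | L * (1 - expdist k x y) < e / 3].
  pose B := [set w : prod_topology (fun _ : V => R) | `|f x - w x| < e / 3 /\
    forall z y, w y <= w z + L * (1 - expdist k z y)].
  exists (A, B).
    by split=> //=; apply: filterI HL; exact: Hpt.
  move=> [y w] /= [yA [wx wL]].
  have yx : L * (1 - expdist k x y) < e / 3 by exact: yA.
  have := wL x y; have := wL y x; have := fL x y; have := fL y x.
  move: wx; rewrite ltr_norml => /andP[? ?]; rewrite (expdistC k y x) => *.
  by rewrite ler_norml; apply/andP; split; lra.
(* Near [H] only terms of the sequence with index at least [N] occur, so an actual index can be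
   picked at the end. *)
have HN : \forall w \near H, exists2 n, (N <= n)%N & w = v n.
  by apply: FH; exists N => // n /= Nn; exists n.
have [w [[wU wO] [n Nn wE]]] := filter_ex (filterI (filterI Hunif HO) HN).
exists n => // x; rewrite -wE.
have [Ox|nOx] := pselect (O x); first exact: wU (subset_closure Ox).
by rewrite wO// fO// subrr normr0 ltW.
Qed.

End Compactness.

(** * Strong minimum principle *)

Section StrongMinimum.
Context {R : realType} {d : nat} (gamma : R) (O : set 'rV[R]_d.+1).
Local Notation V := 'rV[R]_d.+1.
Variables (q : V -> V) (c : V -> R).
Hypotheses (gamma_le2 : gamma <= 2) (oO : open O) (cO : compact (closure O)).
Hypotheses (conO : connected O) (O0 : O !=set0).
Hypotheses (q_cont : {within closure O, continuous q}).
Hypotheses (c_cont : {within closure O, continuous c}).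

(** The positivity set is open by continuity. It is relatively closed because Harnack, centred at a
    positive point [y] close to [x], carries positivity over to [x]; connectedness concludes. *)
Lemma strong_minimum_principle (u : V -> R) : continuous u ->
  (forall x, 0 <= u x) -> (forall x, O x -> super_at gamma q c 0 u x) ->
  (exists2 x, O x & 0 < u x) -> forall x, O x -> 0 < u x.
Proof.
move=> uc u0 us [x0 Ox0 ux0].
have [Q Q0 QP] := drift_bound cO O0 q_cont.
have [C C0 CP] := closure_bound cO O0 c_cont.
pose k := Q + C + 1.
have k0 : 0 < k by rewrite /k; lra.
pose B := O `&` [set x | 0 < u x].
suff BO : B = O by move=> x; rewrite -BO => -[].
apply: conO; first by exists x0.
  exists [set x | 0 < u x] => //.
  have -> : [set x | 0 < u x] = u @^-1` [set r | 0 < r] by [].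
  by apply: open_comp; [move=> x _; exact: uc|exact: open_gt].
exists (closure B); first exact: closed_closure.
apply/seteqP; split=> [x [Ox ux]|x [Ox clx]].
  by split=> //; apply: subset_closure; split.
split=> //=; have [r0 r00 r0P] := iffLR (nbhs_rVP _ _) (open_nbhs_nbhs (conj oO Ox)).
(* Half the radius, so that the ball of radius [r] around any [y] within [r] of [x] stays in [O]. *)
pose r := r0 / 2.
have rpos : 0 < r by rewrite divr_gt0.
have xn : \forall y \near x, enorm (y - x) < r.
  have : sqdist x y @[y --> x] --> sqdist x x by exact: continuous_sqdist.
  have r2 : 0 < r ^+ 2 by rewrite exprn_gt0.
  rewrite sqdistxx => /cvgrPdist_lt/(_ _ r2); apply: filterS => y.
  rewrite sub0r normrN => /(le_lt_trans (ler_norm _)).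
  by rewrite /sqdist -sqr_enorm ltr_pXn2r// ?nnegrE ?enorm_ge0 ?ltW.
have [y [[Oy uy] yx]] := clx _ xn.
have xy : enorm (x - y) < r by rewrite -opprB enormN.
have ball z : enorm (z - y) < r -> O z.
  move=> zy; apply: r0P => j; have := ler_distD (y 0 j) (z 0 j) (x 0 j).
  have := le_lt_trans (coord_le_enorm (z - y) j) zy.
  have := le_lt_trans (coord_le_enorm (y - x) j) yx.
  by rewrite !mxE /r; lra.
have := super_harnack gamma_le2 oO cO (continuous_subspaceT uc) (fun x _ => u0 x)
  (fun x Ox => QP x (subset_closure Ox)) _ us Q0 C0 (lexx k) rpos ball xy.
have er : expR (- k * r) < 1.
  by rewrite -expR0 ltr_expR mulNr oppr_lt0 mulr_gt0.
move=> H; have : 0 < u x * (1 - expR (- k * r)).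
  apply: lt_le_trans (H _); first by rewrite mulr_gt0// subr_gt0 expdist_lt.
  move=> z Oz; have := CP z (subset_closure Oz); rewrite ler_norml.
  by case/andP.
by rewrite pmulr_lgt0// subr_gt0.
Qed.

End StrongMinimum.

(** * Passage to the limit and positivity of the eigenfunction *)

Section Eigenfunction.
Context {R : realType} {d : nat} (gamma : R) (O : set 'rV[R]_d.+1).
Local Notation V := 'rV[R]_d.+1.
Variables (q : V -> V) (c : V -> R).
Hypotheses (gamma_le2 : gamma <= 2) (oO : open O) (cO : compact (closure O)).
Hypotheses (conO : connected O) (O0 : O !=set0).
Hypotheses (q_cont : {within closure O, continuous q}).
Hypotheses (c_cont : {within closure O, continuous c}).

Lemma eigenfunction_exists : let lambda := principal_eigenvalue gamma q c O in
  exists phi : V -> R, [/\ continuous phi, forall x, O x -> 0 < phi x,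
    forall x, O x -> sub_at gamma q (fun x => c x + lambda) 0 phi x,
    forall x, O x -> super_at gamma q (fun x => c x + lambda) 0 phi x &
    forall x, ~ O x -> phi x = 0].
Proof.
move=> lambda.
have en0 (n : nat) : 0 < (n.+1%:R^-1 : R) by rewrite invr_gt0.
pose P n (z : R * R * (V -> R)) :=
  [/\ `|z.1.1| <= n.+1%:R^-1, 0 <= z.1.2 <= n.+1%:R^-1 & continuous z.2] /\
  [/\ forall x, 0 <= z.2 x <= 1, forall x, ~ O x -> z.2 x = 0, exists x, z.2 x = 1,
      forall x, O x -> sub_at gamma q (fun x => c x + lambda + z.1.1) z.1.2 z.2 x &
      forall x, O x -> super_at gamma q (fun x => c x + lambda + z.1.1) z.1.2 z.2 x].
have /choice[z zP] : forall n, exists z, P n z.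
  move=> n; have [kap [del [v H]]] := normalized_approximation gamma_le2
    oO cO O0 q_cont c_cont (en0 n).
  by exists (kap, del, v).
pose v n := (z n).2.
have [Q Q0 QP] := drift_bound cO O0 q_cont.
have [C C0 CP] := closure_bound cO O0 c_cont.
have C1 : 0 <= C + `|lambda| + 1 + 1 by rewrite !addr_ge0.
have [L [k [L0 k0 Lk]]] := sub_equicontinuous gamma_le2 oO cO Q0 C1 ler01.
have n1 n : n.+1%:R^-1 <= 1 :> R by rewrite invf_le1// ler1n.
have vL n x y : v n y <= v n x + L * (1 - expdist k x y).
  have [[zk /andP[zd0 zd] zc] [z01 zO _ zs _]] := zP n.
  apply: (Lk q (fun x => c x + lambda + (z n).1.1) (z n).1.2) => //.
    by move=> t Ot; exact: QP (subset_closure Ot).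
  move=> t Ot; apply: lerD; last exact: le_trans zd (n1 n).
  have /andP[v0 v1] := z01 t.
  have vp : `|(z n).2 t| `^ (3 - gamma) <= 1.
    have one : 1 `^ (3 - gamma) = 1 :> R by rewrite powR1.
    rewrite -[leRHS]one.
    apply: (ge0_ler_powR (gamma_le3 gamma_le2)); [exact: normr_ge0|exact: ler01|].
    by rewrite ger0_norm.
  have cB : `|c t + lambda + (z n).1.1| <= C + `|lambda| + 1.
    apply: (le_trans (ler_normD _ _)); apply: lerD; last exact: le_trans zk (n1 n).
    by apply: (le_trans (ler_normD _ _)); rewrite lerD2r; exact: CP (subset_closure Ot).
  apply: (le_trans (ler_norm _)); rewrite normrM -[leRHS]mulr1.
  by apply: ler_pM => //; rewrite ger0_norm ?powR_ge0.
have [phi phiP] : exists f : V -> R, forall e (N : nat), 0 < e ->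
    exists2 n, (N <= n)%N & forall x, `|v n x - f x| <= e.
  apply: (equicontinuous_cluster cO _ _ vL).
    by move=> n x; have [_ [z01 _ _ _ _]] := zP n; exact: z01.
  by move=> n x; have [_ [_ zO _ _ _]] := zP n; exact: zO.
have app e : 0 < e -> exists n, [/\ forall x, v n x - e <= phi x <= v n x + e,
    `|(z n).1.1| <= e & 0 <= (z n).1.2 <= e].
  (* From this index on, [n.+1] exceeds 1/e, so one [n] makes the uniform error, [kappa] and [delta]
     all at most [e]. *)
  move=> e0; pose N := Num.truncn e^-1.
  have [n Nn vn] := phiP e N e0; exists n.
  have ne : n.+1%:R^-1 <= e.
    rewrite -[leRHS]invrK lef_pV2 ?posrE ?invr_gt0//.
    by apply: (le_trans (ltW (truncnS_gt _))); rewrite ler_nat ltnS.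
  have [[zk /andP[zd0 zd] _] _] := zP n.
  split; [|exact: le_trans ne|by rewrite zd0 (le_trans zd)].
  by move=> x; have := vn x; rewrite ler_norml => /andP[? ?]; apply/andP; split; lra.
have phiL x y : phi y <= phi x + L * (1 - expdist k x y).
  apply/ler_addgt0Pl => e e0; have e2 : 0 < e / 2 by rewrite divr_gt0.
  have [n [vphi _ _]] := app _ e2.
  by have /andP[? ?] := vphi x; have /andP[? ?] := vphi y; have := vL n x y; lra.
have phic : continuous phi by exact: expdist_bound_continuous phiL.
have phi0 x : 0 <= phi x.
  apply/ler_addgt0Pl => e e0; have [n [vphi _ _]] := app _ e0.
  have [_ [/(_ x)/andP[z0 _] _ _ _ _]] := zP n.
  have {}z0 : 0 <= v n x by exact: z0.
  by have /andP[? ?] := vphi x; lra.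
have phiO x : ~ O x -> phi x = 0.
  move=> nOx; apply/eqP; rewrite eq_le phi0 andbT.
  apply/ler_addgt0Pl => e e0; have [n [vphi _ _]] := app _ e0.
  have [_ [_ /(_ x nOx) zx _ _ _]] := zP n.
  have {}zx : v n x = 0 by exact: zx.
  by have /andP[? ?] := vphi x; lra.
have qc x : O x -> {for x, continuous q} by exact: within_closure_at.
have cc x : O x -> {for x, continuous (fun x => c x + lambda)}.
  move=> Ox; apply: (@continuousD _ _ _ c (fun=> lambda)); last exact: cst_continuous.
  exact: within_closure_at Ox.
have sub x : O x -> sub_at gamma q (fun x => c x + lambda) 0 phi x.
  move=> Ox; apply: (sub_at_stable gamma_le2 oO Ox (qc x Ox) (cc x Ox)) => e e0.
  have [n [vphi ke /andP[de0 de]]] := app _ e0.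
  have [[_ _ zc] [_ _ _ zs _]] := zP n.
  exists (z n).1.1, (z n).1.2, (v n); split; first by split=> //; rewrite subr0 ger0_norm.
  split=> // [y|]; first by have /andP[? ?] := vphi y; lra.
  by have /andP[? ?] := vphi x; lra.
have super x : O x -> super_at gamma q (fun x => c x + lambda) 0 phi x.
  move=> Ox; apply: (super_at_stable gamma_le2 oO Ox (qc x Ox) (cc x Ox)) => e e0.
  have [n [vphi ke /andP[de0 de]]] := app _ e0.
  have [[_ _ zc] [_ _ _ _ zs]] := zP n.
  exists (z n).1.1, (z n).1.2, (v n); split; first by split=> //; rewrite subr0 ger0_norm.
  split=> // [y|]; first by have /andP[? ?] := vphi y; lra.
  by have /andP[? ?] := vphi x; lra.
exists phi; split=> //.
have clc : {within closure O, continuous (fun x => c x + lambda)}.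
  move=> x; apply: (@continuousD _ _ (subspace (closure O)) c (fun=> lambda)).
    exact: c_cont.
  exact: cst_continuous.
apply: (strong_minimum_principle gamma_le2 oO cO conO O0 q_cont clc phic phi0 super).
(* The limit is not zero: some [v n] attains 1 and lies within 1/2 of [phi] everywhere. *)
have half : 0 < 1 / 2 :> R by rewrite divr_gt0.
have [n [vphi _ _]] := app _ half.
have [_ [_ _ [x zx] _ _]] := zP n.
have {}zx : v n x = 1 by exact: zx.
have px : 0 < phi x by have /andP[? ?] := vphi x; lra.
exists x => //; apply: contrapT => /phiO px0.
by move: px; rewrite px0 ltxx.
Qed.

End Eigenfunction.

Theorem theorem3p1 (R : realType) (d : nat) (gamma : R) (O : set 'rV[R]_d.+1)
    (q : 'rV[R]_d.+1 -> 'rV[R]_d.+1) (c : 'rV[R]_d.+1 -> R)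
    (gamma_ge0 : 0 <= gamma) (gamma_le2 : gamma <= 2)
    (domO : bounded_C1_domain O)
    (q_cont : {within closure O, continuous q})
    (c_cont : {within closure O, continuous c}) :
  exists phi : 'rV[R]_d.+1 -> R,
    [/\ {within closure O, continuous phi},
        forall x, O x -> 0 < phi x,
        visc_solution gamma
          (eigen_G gamma q c (principal_eigenvalue gamma q c O)) O phi &
        forall x, boundary O x -> phi x = 0].
Proof.
have [oO conO O0 bO _] := domO.
have cO : compact (closure O).
  apply: bounded_closed_compact; last exact: closed_closure.
  rewrite /bounded_set /bounded_near in bO *.
  apply: filterS bO => M OM x xO.
  have cM : closed [set y : 'rV[R]_d.+1 | `|y| <= M].
    apply: (@preimage_closed _ _ (fun y : 'rV[R]_d.+1 => `|y|) [set r : R | r <= M]).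
      by move=> y _; exact: norm_continuous.
    exact: closed_le.
  by apply: cM; apply: closure_subset xO => y /OM.
have [phi [phic phi0 phisub phisup phiO]] :=
  eigenfunction_exists gamma_le2 oO cO conO O0 q_cont c_cont.
(* [eigen_G] takes the power of the value itself; positivity of [phi] in [O] identifies it with
   [Gop]. *)
have GE x p : O x -> eigen_G gamma q c (principal_eigenvalue gamma q c O) x (phi x) p =
    Gop gamma q (fun x => c x + principal_eigenvalue gamma q c O) 0 x (phi x) p.
  by move=> Ox; apply: eigen_GE; exact/ltW/phi0.
exists phi; split=> //.
- exact: continuous_subspaceT.
- split; [exact: sub_at_visc GE phisub|apply: super_at_visc GE phisup => x _].
  exact: phic.
- by move=> x [_ nIx]; apply: phiO => Ox; apply: nIx; exact: open_nbhs_nbhs.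
Qed.
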